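(* Let $(V,E)$ be a connected finite graph with symmetric positive weights, let $X=L^\infty(V)$, let $\lambda,\eta\in\mathbb{R}$ and $f,g:V\to\mathbb{R}$, and let $\mathcal{F}:X\times X\to X\times X$ be the map $$\mathcal{F}(u,v)=\left(-\Delta u+\lambda e^{v}(e^u-1)+f,\ -\Delta v+\eta e^u(e^v-1)+g\right).$$ If $\lambda>0$, $\eta>0$, $\int_V f\,d\mu>0$ and $\int_V g\,d\mu>0$, then there exists a large number $R_0>0$ such that for all $R\geq R_0$, $$\deg(\mathcal{F},B_R,(0,0))=0,$$ where $B_R=\{(u,v)\in X\times X:\|u\|_{L^\infty(V)}+\|v\|_{L^\infty(V)}<R\}$.
   Context: $(V,E)$ is a connected finite graph with vertex set $V$ and edge set $E$, equipped with a measure $\mu:V\to(0,+\infty)$ and weights $\{w_{xy}:xy\in E\}$ which are positive and symmetric ($w_{xy}=w_{yx}$). Write $y\sim x$ if $xy\in E$. For $u:V\to\mathbb{R}$, $\Delta u(x)=\frac{1}{\mu(x)}\sum_{y\sim x}w_{xy}(u(y)-u(x))$, $\int_V u\,d\mu=\sum_{x\in V}\mu(x)u(x)$, $\|u\|_{L^\infty(V)}=\max_{x\in V}|u(x)|$. $X=L^\infty(V)$ is the space of all functions $V\to\mathbb{R}$, identified with $\mathbb{R}^\ell$, where $\ell$ is the number of vertices; $\deg$ is the Brouwer (topological) degree on $X\times X\cong\mathbb{R}^{2\ell}$. *)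

(* Defs.v *)
From HB Require Import structures.
From mathcomp Require Import all_boot all_order all_algebra.
From mathcomp Require Import all_classical all_reals all_analysis.
Set Implicit Arguments.
Unset Strict Implicit.
Unset Printing Implicit Defensive.
Import Order.TTheory GRing.Theory Num.Theory.
Import numFieldNormedType.Exports.
Local Open Scope classical_set_scope.
Local Open Scope ring_scope.

Section BrouwerDegree.
Variable R : realType.

(* For an open set A, membership in class C^k on A. *)
Fixpoint class_C (k : nat) (n : nat) (W : normedModType R)
    (A : set 'rV[R]_n) (f : 'rV[R]_n -> W) : Prop :=
  match k with
  | 0 => forall x, A x -> {for x, continuous f}
  | k'.+1 => (forall x, A x -> differentiable f x) /\
             (forall v : 'rV[R]_n, class_C k' A ('D_v f))
  end.

(* Iterated Lebesgue integral over R^n; by Fubini it is the n-dimensional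
   Lebesgue integral on the continuous, compactly supported integrands to
   which it is applied below. *)
Fixpoint iintegral (n : nat) : ('rV[R]_n -> R) -> R :=
  match n with
  | 0 => fun f => f 0
  | m.+1 => fun f =>
      \int[lebesgue_measure]_x
        iintegral (fun t : 'rV[R]_m => f (row_mx (x%:M : 'rV[R]_1) t))
  end.

(* [degree_data A f y r g phi]: g is a C^2 approximation of f to within r, and
   phi a C^1 density of total mass 1 supported in the closed r-ball around y.
   Every boundary value of g is at distance > r from y, so phi \o g vanishes
   near the boundary of A. *)
Definition degree_data n (A : set 'rV[R]_n) (f : 'rV[R]_n -> 'rV[R]_n)
    (y : 'rV[R]_n) (r : R) (g : 'rV[R]_n -> 'rV[R]_n) (phi : 'rV[R]_n -> R) :=
  [/\ 0 < r,
      forall x, (closure A `\` A) x -> 2 * r < `|f x - y|,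
      {within closure A, continuous g} /\ class_C 2 A g,
      forall x, closure A x -> `|g x - f x| <= r
    & [/\ class_C 1 setT phi,
          forall z, r < `|z - y| -> phi z = 0
        & iintegral phi = 1] ].

(* Integral formula for the degree (Heinz):
     deg(f, A, y) = \int_A phi(g(x)) det(g'(x)) dx.
   [is_brouwer_degree A f y d] asserts both that the degree of f on A at y is
   defined and that it equals d.  It is a relation because a total function
   would take a junk value when y is attained on the boundary of A.  The value
   is a real number; that it is an integer is a theorem. *)
Definition is_brouwer_degree n (A : set 'rV[R]_n)
    (f : 'rV[R]_n -> 'rV[R]_n) (y : 'rV[R]_n) (d : R) :=
  [/\ open A /\ bounded_set A,
      {within closure A, continuous f},
      forall x, (closure A `\` A) x -> f x <> y,
      exists r g phi, degree_data A f y r g phi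
    & forall r g phi, degree_data A f y r g phi ->
        iintegral (fun x => \1_A x * (phi (g x) * \det ('J g x))) = d].

End BrouwerDegree.

Section Graph.
Variables (R : realType) (V : finType).

Definition connected_graph (e : rel V) := forall x y : V, connect e x y.

Definition laplacian (e : rel V) (w : V -> V -> R) (mu : V -> R)
    (u : V -> R) (x : V) : R :=
  (mu x)^-1 * \sum_(y | e x y) w x y * (u y - u x).

Definition integral_V (mu : V -> R) (u : V -> R) : R :=
  \sum_(x in V) mu x * u x.

(* The maximum of |u| over V, with value 0 if V is empty. *)
Definition norm_oo (u : V -> R) : R := \big[Num.max/0]_(x in V) `|u x|.

Local Notation XX := ((V -> R) * (V -> R))%type.

Definition calF (e : rel V) (w : V -> V -> R) (mu : V -> R)
    (lambda eta : R) (f g : V -> R) (p : XX) : XX :=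
  let: (u, v) := p in
  (fun x => - laplacian e w mu u x
            + lambda * expR (v x) * (expR (u x) - 1) + f x,
   fun x => - laplacian e w mu v x
            + eta * expR (u x) * (expR (v x) - 1) + g x).

Definition B_ (r : R) : set XX := [set p | norm_oo p.1 + norm_oo p.2 < r].

(* Identification of X * X with R^(2l), l = #|V|, through the enumeration of
   V; the same coordinates are used in the source and in the target, so the
   degree does not depend on the enumeration. *)
Definition to_coord (p : XX) : 'rV[R]_(#|V| + #|V|) :=
  row_mx (\row_i p.1 (enum_val i)) (\row_i p.2 (enum_val i)).

Definition of_coord (z : 'rV[R]_(#|V| + #|V|)) : XX :=
  (fun x => lsubmx z 0 (enum_rank x), fun x => rsubmx z 0 (enum_rank x)).

Definition is_degree_XX (F : XX -> XX) (A : set XX) (y : XX) (d : R) :=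
  is_brouwer_degree (of_coord @^-1` A) (to_coord \o F \o of_coord)
    (to_coord y) d.

End Graph.

(* Main.v *)
(* Along the segment F + t h, t in [0,1], where h is the constant vector that
   turns (f, g) into the constant functions (lambda, eta), all zeros lie in one
   fixed ball: the integrals of f and g stay bounded below by a positive
   constant, and a maximum principle propagated along paths of the graph bounds u
   and v.  The endpoint F + h has no zero at all: at a maximum of u and at a
   maximum of v the equations give u < 0 and v < 0 everywhere, and then
   lambda e^v (e^u - 1) + lambda > 0 contradicts Laplacian u <= 0 at a maximum of
   u.

   For an approximation g of F and a density phi supported in the ball of radius
   r, phi is kept fixed and g is deformed to S F and then to S (F + h), S being a
   large constant.  All boundary values stay at distance > r from 0, and at the
   end so do all values, so that the integral vanishes.  The integral
   of phi(G_s) det DG_s is invariant because its s-derivative is the integral of a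
   divergence of a compactly supported field.  That such integrals vanish follows
   from translation invariance of the iterated integral and differentiation under
   the integral sign, without Fubini's theorem. *)

Require Import Defs.
From mathcomp Require Import all_boot all_order all_algebra.
From mathcomp Require Import all_classical all_reals all_analysis.
From mathcomp Require Import ring lra perm.
Import Order.TTheory GRing.Theory Num.Theory.
Import numFieldNormedType.Exports.
Set Implicit Arguments.
Unset Strict Implicit.
Unset Printing Implicit Defensive.
Local Open Scope classical_set_scope.
Local Open Scope ring_scope.

(** * Iterated integrals of continuous functions with bounded support *)

(** [is_brouwer_degree] demands the same value for every admissible [r], [g] and [phi], and such
    data only place F farther than [2 * r] from 0 on the boundary. Along F + t h the boundary values
    are merely nonzero, with a lower bound unrelated to [r]. The a priori bounds must cope with the
    coupling: the coefficient e^v in the equation of u is not controlled in advance. Integrating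
    that equation equates the integral of lambda e^v (1 - e^u) with that of f, which is positive.
    Hence u is negative somewhere, and e^v is not small everywhere. The first fact, with the sign of
    e^u - 1 where u >= 0, bounds u above without any knowledge of v; the second starts the lower
    bound of v. Each equation thus bounds its own unknown from above and supplies the other one with
    a vertex where it is not very negative. *)

Section LineIntegral.
Variable R : realType.

Lemma cvg_mx (T : Type) (F : set_system T) {FF : Filter F} m n
    (M : T -> 'M[R]_(m, n)) (N : 'M[R]_(m, n)) :
  (forall i j, M t i j @[t --> F] --> N i j) -> M @ F --> N.
Proof.
move=> MN; apply/cvgrPdist_le => e e0.
near=> t.
rewrite /Num.Def.normr/= mx_normrE (bigmax_le _ (ltW e0))//= => i _.
rewrite !mxE/=; move: i; near: t; apply: filter_forall => /= i.
exact: ((cvgrPdist_le _ _).1 (MN i.1 i.2)).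
Unshelve. all: by end_near. Qed.

Lemma cvg_coord (T : Type) (F : set_system T) {FF : Filter F} m n
    (M : T -> 'M[R]_(m, n)) (N : 'M[R]_(m, n)) i j :
  M @ F --> N -> M t i j @[t --> F] --> N i j.
Proof. move=> MN; exact: (cvg_comp _ _ MN (@coord_continuous R m n i j N)). Qed.

Lemma coord_le_norm m n (M : 'M[R]_(m, n)) i j : `|M i j| <= `|M|.
Proof.
rewrite [leRHS]/Num.Def.normr/= mx_normrE.
exact: (le_bigmax _ _ (i, j)).
Qed.

Lemma norm_mx_le m n (M : 'M[R]_(m, n)) (c : R) :
  0 <= c -> (forall i j, `|M i j| <= c) -> `|M| <= c.
Proof.
move=> c0 Mc; rewrite /Num.Def.normr/= mx_normrE.
by apply: bigmax_le.
Qed.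

Lemma cvg_pairE (T : Type) (F : set_system T) {FF : Filter F}
    (U W : topologicalType) (f : T -> U) (g : T -> W) (a : U) (b : W) :
  f @ F --> a -> g @ F --> b -> (f t, g t) @[t --> F] --> (a, b).
Proof. exact: cvg_pair. Qed.

Definition cons_rv n (x : R) (t : 'rV[R]_n) : 'rV[R]_n.+1 :=
  row_mx (x%:M : 'rV[R]_1) t.

Lemma cons_rv0 n x (t : 'rV[R]_n) i : cons_rv x t i ord0 = x.
Proof.
have -> : (ord0 : 'I_n.+1) = lshift n (ord0 : 'I_1) by exact: val_inj.
by rewrite (row_mxEl (x%:M : 'rV[R]_1) t) mxE (ord1 i) eqxx mulr1n.
Qed.

Lemma cons_rvS n x (t : 'rV[R]_n) i j : cons_rv x t i (lift ord0 j) = t i j.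
Proof.
have -> : lift ord0 j = rshift 1 j by exact: val_inj.
by rewrite (row_mxEr (x%:M : 'rV[R]_1) t).
Qed.

Lemma norm_cons_rv_ge n (x : R) (t : 'rV[R]_n) :
  `|x| <= `|cons_rv x t| /\ `|t| <= `|cons_rv x t|.
Proof.
split; first by rewrite -{1}(cons_rv0 x t ord0); exact: coord_le_norm.
apply: norm_mx_le => // i j.
by rewrite -(cons_rvS x t); exact: coord_le_norm.
Qed.

Lemma cons_rv_cvg (T : Type) (F : set_system T) {FF : Filter F} n
    (x : T -> R) (t : T -> 'rV[R]_n) a b :
  x @ F --> a -> t @ F --> b -> cons_rv (x u) (t u) @[u --> F] --> cons_rv a b.
Proof.
move=> xa tb; apply: cvg_mx => i j.
case: (unliftP ord0 j) => [k|] ->.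
  under eq_fun do rewrite cons_rvS.
  by rewrite cons_rvS; exact: cvg_coord.
under eq_fun do rewrite cons_rv0.
by rewrite cons_rv0.
Qed.

Notation leb := (@lebesgue_measure R).

Lemma Cc_integrable (L : R) (f : R -> R) (D : set R) : measurable D ->
  continuous f -> (forall x, L < `|x| -> f x = 0) ->
  leb.-integrable D (EFin \o f).
Proof.
move=> mD fc f0; apply: (@integrableS _ _ _ _ setT) => //.
rewrite (_ : EFin \o f = (EFin \o f) \_ `[- L, L]); last first.
  apply/funext => x; rewrite patchE.
  case: ifPn => //; rewrite notin_setE /= in_itv /= => /negP.
  by rewrite -ler_norml -ltNge => /f0 ->.
apply/(integrable_mkcond _ _).1 => //.
apply: continuous_compact_integrable; first exact: segment_compact.
exact: continuous_subspaceT.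
Qed.

Lemma Rintegral_cc_itv (a b : R) (f : R -> R) :
  (forall x, x \notin `[a, b] -> f x = 0) ->
  \int[leb]_x f x = \int[leb]_(x in `[a, b]) f x.
Proof.
move=> f0; rewrite [RHS]Rintegral_mkcond; congr Rintegral.
apply/funext => x; rewrite patchE.
by case: ifPn => //; rewrite notin_setE /= => /negP; exact: f0.
Qed.

Lemma Rintegral_cc (L : R) (f : R -> R) :
  (forall x, L < `|x| -> f x = 0) ->
  \int[leb]_x f x = \int[leb]_(x in `[- L, L]) f x.
Proof.
move=> f0; apply: Rintegral_cc_itv => x.
by rewrite in_itv/= -ler_norml -ltNge; exact: f0.
Qed.

Lemma Rintegral_cc_le (L c : R) (f : R -> R) : 0 <= L ->
  continuous f -> (forall x, L < `|x| -> f x = 0) ->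
  (forall x, `|f x| <= c) -> `|\int[leb]_x f x| <= c * (2 * L).
Proof.
move=> L0 fc f0 fle; rewrite (Rintegral_cc f0).
have mI : measurable (`[- L, L] : set R) by exact: measurable_itv.
apply: le_trans.
  by apply: le_normr_Rintegral => //; exact: Cc_integrable fc f0.
apply: (@le_trans _ _ (\int[leb]_(x in `[- L, L]) c)).
  apply: le_Rintegral => //.
  - apply: (@Cc_integrable L (fun x => `|f x|)) => //.
    + by move=> x; apply: cvg_norm; exact: fc.
    + by move=> x /f0 ->; rewrite normr0.
  - apply: continuous_compact_integrable; first exact: segment_compact.
    by apply: continuous_subspaceT; exact: cst_continuous.
rewrite Rintegral_cst// [X in fine X]lebesgue_measure_itv /= lte_fin.
case: ifPn => _; first by rewrite opprK mulr2n mulrDl mul1r.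
by rewrite mulr0; have := fle 0; have := normr_ge0 (f 0); nra.
Qed.

(** Compactness of [[- L, L]] turns joint continuity into closeness uniform in [x]; outside this
    interval both integrands vanish. *)
Lemma Rintegral_param_continuous (T : topologicalType) (L : R)
    (f : T * R -> R) : 0 <= L -> continuous f ->
  (forall t x, L < `|x| -> f (t, x) = 0) ->
  continuous (fun t => \int[leb]_x f (t, x)).
Proof.
move=> L0 fc f0 t0.
have fct t : continuous (fun x => f (t, x)).
  move=> x; apply: (cvg_comp (fun x => (t, x)) f _ (fc (t, x))).
  by apply: cvg_pairE; [exact: cvg_cst|exact: cvg_id].
apply/cvgrPdist_le => e e0.
(* The interval has length [2 * L]; adding 1 covers [L = 0]. *)
pose d := e / (2 * L + 1).
have d0 : 0 < d by rewrite divr_gt0// ltr_wpDl// mulr_ge0.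
have /compact_near_coveringP := @segment_compact R (- L) L.
move=> /(_ T (nbhs t0) (fun t x => `|f (t0, x) - f (t, x)| <= d) (nbhs_filter t0)).
have /[swap] /[apply] : forall x, `[- L, L]%classic x ->
    \forall x' \near x & t \near t0, `|f (t0, x') - f (t, x')| <= d.
  move=> x _.
  have h1 : f (p.2, p.1) @[p --> (x, t0)] --> f (t0, x).
    apply: (cvg_comp (fun p : R * T => (p.2, p.1)) f _ (fc (t0, x))).
    by apply: cvg_pairE; [exact: cvg_snd|exact: cvg_fst].
  have h2 : f (t0, p.1) @[p --> (x, t0)] --> f (t0, x).
    apply: (cvg_comp (fun p : R * T => p.1) (fun x => f (t0, x)) _ (fct t0 x)).
    exact: cvg_fst.
  have d2 : 0 < d / 2 by rewrite divr_gt0.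
  near=> p.
  have -> : f (t0, p.1) - f (p.2, p.1) =
    (f (t0, x) - f (p.2, p.1)) - (f (t0, x) - f (t0, p.1)) by ring.
  rewrite (le_trans (ler_normB _ _))// (splitr d) lerD//.
    by near: p; exact: (cvgrPdist_le _ _).1 h1 _ d2.
  by near: p; exact: (cvgrPdist_le _ _).1 h2 _ d2.
move=> /filterS; apply => t /= ft.
have iL t' : leb.-integrable setT (EFin \o (fun x => f (t', x))).
  by apply: (Cc_integrable _ (fct t') (f0 t')).
rewrite -RintegralB//.
apply: (@le_trans _ _ (d * (2 * L))); last first.
  rewrite /d mulrAC ler_pdivrMr; last by rewrite ltr_wpDl// mulr_ge0.
  by rewrite ler_pM2l//; lra.
apply: Rintegral_cc_le => //.
- by move=> x; apply: cvgB; exact: fct.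
- by move=> x Lx; rewrite !f0// subrr.
- move=> x; have [xL|/f0 fL] := leP `|x| L; last by rewrite !fL subrr normr0 ltW.
  by apply: ft; rewrite /= in_itv/= -ler_norml.
Unshelve. all: by end_near. Qed.

End LineIntegral.

Section IteratedIntegral.
Variable R : realType.
Notation leb := (@lebesgue_measure R).

Lemma Rintegral_shift (L a : R) (f : R -> R) :
  continuous f -> (forall x, L < `|x| -> f x = 0) ->
  \int[leb]_x f (x + a) = \int[leb]_x f x.
Proof.
move=> fc f0.
(* Large enough for [[- M, M]] to contain the support of the shifted function and for its translate
   by [a] to contain that of [f]; the substitution is then made between compact intervals. *)
pose M := `|L| + 1 + `|a|.
have LM : L < M.
  by rewrite /M; have := ler_norm L; have := normr_ge0 a; lra.
have M0 : 0 <= M by rewrite /M !addr_ge0.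
rewrite (@Rintegral_cc_itv R (- M) M); last first.
  move=> x; rewrite in_itv/= -ler_norml -ltNge => Mx; apply: f0.
  rewrite -(addrK a x) in Mx; have := lt_le_trans Mx (ler_normB _ _).
  by rewrite /M; have := ler_norm L; lra.
rewrite (@Rintegral_cc_itv R (- M + a) (M + a) f); last first.
  move=> x xM; apply: f0; rewrite ltNge; apply: contra xM.
  rewrite ler_norml in_itv/= /M => /andP[h1 h2].
  have := ler_norm a; have := ler_norm (- a); have := ler_norm L.
  by rewrite normrN; lra.
congr fine.
have dF : derive1 (fun x : R => x + a) = cst 1.
  apply/funext => x; rewrite derive1E.
  transitivity ('D_1 (id + cst a) x) => //.
  by rewrite deriveD// derive_id derive_cst addr0.
rewrite (@integration_by_substitution_increasing R (fun x => x + a) f (- M) M).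
- by apply: eq_integral => x _ /=; rewrite dF/= mulr1.
- by rewrite ge0_cp.
- by move=> x y _ _; rewrite ltrD2r.
- by rewrite dF => x _; exact: cst_continuous.
- by rewrite dF; exact: is_cvg_cst.
- by rewrite dF; exact: is_cvg_cst.
- split.
  + move=> x _; apply: derivableD; first exact: derivable_id.
    exact: derivable_cst.
  + apply: cvgD; last exact: cvg_cst.
    by apply: cvg_at_right_filter; exact: cvg_id.
  + apply: cvgD; last exact: cvg_cst.
    by apply: cvg_at_left_filter; exact: cvg_id.
- exact: continuous_subspaceT.
Qed.

Lemma iintegralS n (f : 'rV[R]_n.+1 -> R) :
  iintegral f = \int[leb]_x iintegral (fun t => f (cons_rv x t)).
Proof. by []. Qed.

Lemma iintegral0 n : iintegral (fun _ : 'rV[R]_n => 0 : R) = 0.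
Proof.
elim: n => [//|n IH]; rewrite iintegralS IH.
by rewrite Rintegral_cst// mul0r.
Qed.

Definition Cc_ball n (L : R) (f : 'rV[R]_n -> R) :=
  continuous f /\ forall x, L < `|x| -> f x = 0.

(** The norm on row vectors is the sup norm, so fixing a coordinate keeps the radius: a single [L]
    serves all inductions on the dimension. *)
Lemma Cc_ball_cons n L (f : 'rV[R]_n.+1 -> R) x : Cc_ball L f ->
  Cc_ball L (fun t => f (cons_rv x t)).
Proof.
move=> [fc f0]; split=> t.
  apply: (cvg_comp (cons_rv x) f _ (fc (cons_rv x t))).
  by apply: (@cons_rv_cvg R _ (nbhs t) _ _ (fun=> x) id); [exact: cvg_cst|exact: cvg_id].
by move=> Lt; apply: f0; apply: lt_le_trans Lt (norm_cons_rv_ge _ _).2.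
Qed.

Lemma cons_out n L (f : 'rV[R]_n.+1 -> R) x : (forall x, L < `|x| -> f x = 0) ->
  L < `|x| -> (fun t => f (cons_rv x t)) = (fun=> 0).
Proof.
move=> f0 Lx; apply/funext => t; apply: f0.
exact: lt_le_trans Lx (norm_cons_rv_ge _ _).1.
Qed.

(** The parameter space is arbitrary because the induction adjoins the outer integration variable to
    it: the inner integral is continuous on [T * R]. *)
Lemma iintegral_param_continuous n (T : topologicalType) (L : R)
    (f : T * 'rV[R]_n -> R) : 0 <= L -> continuous f ->
  (forall t x, L < `|x| -> f (t, x) = 0) ->
  continuous (fun t => iintegral (fun x => f (t, x))).
Proof.
move=> L0; elim: n T f => [|n IH] T f fc f0.
  move=> t /=.
  have H : (u, 0 : 'rV[R]_0) @[u --> t] --> (t, 0 : 'rV[R]_0).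
    by apply: cvg_pairE; [exact: cvg_id|exact: cvg_cst].
  exact: (cvg_comp _ _ H (fc _)).
pose g (p : T * R) := iintegral (fun t => f (p.1, cons_rv p.2 t)).
apply: (@Rintegral_param_continuous R T L g) => //.
  apply: (IH (T * R)%type (fun q => f (q.1.1, cons_rv q.1.2 q.2))).
    move=> q; apply: (cvg_comp (fun q => (q.1.1, cons_rv q.1.2 q.2)) f _ (fc _)).
    apply: cvg_pairE.
      by apply: (@cvg_comp _ _ _ fst fst (nbhs q) (nbhs q.1)); exact: cvg_fst.
    apply: cons_rv_cvg; last exact: cvg_snd.
    by apply: (@cvg_comp _ _ _ fst snd (nbhs q) (nbhs q.1)); [exact: cvg_fst|exact: cvg_snd].
  by move=> t x Lx; apply: f0; apply: lt_le_trans Lx (norm_cons_rv_ge _ _).2.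
move=> t x Lx; rewrite /g/= (@cons_out n L (fun y => f (t, y))) ?iintegral0//; exact: f0.
Qed.

Lemma Cc_iintegral_cons n L (f : 'rV[R]_n.+1 -> R) : 0 <= L -> Cc_ball L f ->
  continuous (fun x => iintegral (fun t => f (cons_rv x t))) /\
  forall x, L < `|x| -> iintegral (fun t => f (cons_rv x t)) = 0.
Proof.
move=> L0 [fc f0]; split; last by move=> x Lx; rewrite (cons_out f0)// iintegral0.
apply: (@iintegral_param_continuous n R L (fun p => f (cons_rv p.1 p.2))) => //.
  move=> p; apply: (cvg_comp (fun p => cons_rv p.1 p.2) f _ (fc _)).
  by apply: cons_rv_cvg; [exact: cvg_fst|exact: cvg_snd].
by move=> t x Lx; apply: f0; apply: lt_le_trans Lx (norm_cons_rv_ge _ _).2.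
Qed.

Lemma iintegral_integrable n L (f : 'rV[R]_n.+1 -> R) : 0 <= L -> Cc_ball L f ->
  leb.-integrable setT (EFin \o (fun x => iintegral (fun t => f (cons_rv x t)))).
Proof.
move=> L0 /(Cc_iintegral_cons L0)[gc g0].
exact: (Cc_integrable _ gc g0).
Qed.

Lemma Cc_ballD n L (f g : 'rV[R]_n -> R) : Cc_ball L f -> Cc_ball L g -> Cc_ball L (fun x => f x + g x).
Proof.
move=> [fc f0] [gc g0]; split=> x; first exact: (cvgD (fc x) (gc x)).
by move=> Lx; rewrite f0// g0// addr0.
Qed.

Lemma Cc_ballZ n L k (f : 'rV[R]_n -> R) : Cc_ball L f -> Cc_ball L (fun x => k * f x).
Proof.
move=> [fc f0]; split=> x; first exact: (cvgM (cvg_cst k) (fc x)).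
by move=> Lx; rewrite f0// mulr0.
Qed.

Lemma iintegralD n L (f g : 'rV[R]_n -> R) : 0 <= L -> Cc_ball L f -> Cc_ball L g ->
  iintegral (fun x => f x + g x) = iintegral f + iintegral g.
Proof.
move=> L0; elim: n f g => [//|n IH] f g cf cg.
rewrite !iintegralS -RintegralD//; try exact: (iintegral_integrable L0).
congr Rintegral; apply/funext => x; apply: IH; exact: Cc_ball_cons.
Qed.

Lemma iintegralZ n L k (f : 'rV[R]_n -> R) : 0 <= L -> Cc_ball L f ->
  iintegral (fun x => k * f x) = k * iintegral f.
Proof.
move=> L0; elim: n f => [//|n IH] f cf.
rewrite !iintegralS -RintegralZl//; try exact: (iintegral_integrable L0).
congr Rintegral; apply/funext => x; apply: IH; exact: Cc_ball_cons.
Qed.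

Lemma iintegral_sum n L (I : Type) (s : seq I) (f : I -> 'rV[R]_n -> R) :
  0 <= L -> (forall i, Cc_ball L (f i)) ->
  Cc_ball L (fun x => \sum_(i <- s) f i x) /\
  iintegral (fun x => \sum_(i <- s) f i x) = \sum_(i <- s) iintegral (f i).
Proof.
move=> L0 cf; elim: s => [|i s [IH1 IH2]].
  rewrite big_nil (_ : (fun x => _) = (fun=> 0)) ?iintegral0.
    by split=> //; split => // x; exact: cst_continuous.
  by apply/funext => x; rewrite big_nil.
have -> : (fun x => \sum_(j <- i :: s) f j x) =
    (fun x => f i x + \sum_(j <- s) f j x).
  by apply/funext => x; rewrite big_cons.
by split; [exact: Cc_ballD|rewrite (iintegralD L0)// IH2 big_cons].
Qed.

(** The first coordinate of [v] is absorbed by the outer integral and the others by induction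
    inside; the order of integration never changes. *)
Lemma iintegral_shift n L (f : 'rV[R]_n -> R) v : 0 <= L -> Cc_ball L f ->
  iintegral (fun x => f (x + v)) = iintegral f.
Proof.
move=> L0; elim: n f v => [|n IH] f v cf.
  by rewrite /= (thinmx0 v) addr0.
have vE : v = cons_rv (v 0 ord0) (\row_j v 0 (lift ord0 j)).
  apply/rowP => j; case: (unliftP ord0 j) => [k|] ->.
    by rewrite cons_rvS mxE.
  by rewrite cons_rv0.
have cD a b t u : cons_rv a t + cons_rv b u = cons_rv (a + b) (t + u) :> 'rV[R]_n.+1.
  apply/rowP => j; rewrite mxE; case: (unliftP ord0 j) => [k|] ->.
    by rewrite !cons_rvS mxE.
  by rewrite !cons_rv0.
rewrite !iintegralS.
have [gc g0] := Cc_iintegral_cons L0 cf.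
rewrite -[RHS](Rintegral_shift (v 0 ord0) gc g0).
congr Rintegral; apply/funext => x.
under [in LHS]eq_fun do rewrite {1}vE cD.
exact: (IH (fun t => f (cons_rv (x + v 0 ord0) t)) _ (Cc_ball_cons _ cf)).
Qed.

End IteratedIntegral.

(** * Differentiation under the iterated integral, and positivity of the integral *)

Section DerivativeUnderIntegral.
Variable R : realType.
Notation leb := (@lebesgue_measure R).

Lemma is_deriveE (V W : normedModType R) (f : V -> W) a v df :
  h^-1 *: (f (h *: v + a) - f a) @[h --> 0^'] --> df -> is_derive a v f df.
Proof.
move=> H; apply: DeriveDef; first by apply/cvg_ex; exists df.
by apply/cvg_lim.
Qed.

Lemma is_derive_line (V W : normedModType R) (f : V -> W) a v s df :
  is_derive (s *: v + a) v f df ->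
  is_derive s (1 : R) (fun t => f (t *: v + a)) df.
Proof.
move=> [fd <-].
have E : (fun h : R => h^-1 *: (f (h *: v + (s *: v + a)) - f (s *: v + a))) =
    (fun h => h^-1 *: (f ((h *: 1 + s) *: v + a) - f (s *: v + a))).
  by apply/funext => h; rewrite [h *: 1]mulr1 scalerDl addrA.
by apply: is_deriveE; rewrite -E; exact: fd.
Qed.

(** A mean value theorem with no order between [a] and [b], so that increments of either sign are
    treated at once. *)
Lemma mvt_abs (f df : R -> R) a b :
  (forall t, `|t - a| <= `|b - a| -> is_derive t (1 : R) f (df t)) ->
  exists2 c, `|c - a| <= `|b - a| & f b - f a = df c * (b - a).
Proof.
move=> fd.
have cts t : `|t - a| <= `|b - a| -> {for t, continuous f}.
  move=> /fd H; apply: differentiable_continuous.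
  by apply/derivable1_diffP; exact: ex_derive.
have [ab|ba] := leP a b.
  have Hin t : t \in `[a, b] -> `|t - a| <= `|b - a|.
    rewrite in_itv/= => /andP[h1 h2].
    by rewrite !ger0_norm ?subr_ge0// lerD2r.
  have [|t tI|c cab E] := @MVT_segment R f df a b ab.
  - by move=> t tab; apply: fd; apply: Hin; exact: subset_itv_oo_cc.
  - apply: continuous_in_subspaceT => t'; rewrite inE => /Hin; exact: cts.
  - by exists c => //; exact: Hin.
have Hin t : t \in `[b, a] -> `|t - a| <= `|b - a|.
  rewrite in_itv/= => /andP[h1 h2].
  by rewrite ler0_norm ?subr_le0// ltr0_norm ?subr_lt0// lerN2 lerD2r.
have [|t tI|c cab E] := @MVT_segment R f df b a (ltW ba).
- by move=> t tab; apply: fd; apply: Hin; exact: subset_itv_oo_cc.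
- apply: continuous_in_subspaceT => t'; rewrite inE => /Hin; exact: cts.
- exists c; first exact: Hin.
  by rewrite -opprB E -mulrN opprB.
Qed.

Lemma is_derive_iintegral n L (f q : R * 'rV[R]_n -> R) t :
  0 <= L -> continuous f -> continuous q ->
  (forall t x, L < `|x| -> f (t, x) = 0) ->
  (forall t x, L < `|x| -> q (t, x) = 0) ->
  (forall t x, is_derive t (1 : R) (fun t => f (t, x)) (q (t, x))) ->
  is_derive t (1 : R) (fun t => iintegral (fun x => f (t, x)))
    (iintegral (fun x => q (t, x))).
Proof.
move=> L0 fc qc f0 q0 fd.
(* The difference quotient, extended by the derivative at increment 0, is
   jointly continuous. *)
pose rho (p : R * 'rV[R]_n) :=
  if p.1 == 0 then q (t, p.2) else p.1^-1 * (f (p.1 + t, p.2) - f (t, p.2)).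
have sc (s : R) (x : 'rV[R]_n) :
    {for (s, x), continuous (fun p : R * 'rV[R]_n => f (p.1 + t, p.2))}.
  have H : (p.1 + t, p.2) @[p --> (s, x)] --> (s + t, x).
    apply: cvg_pairE; last exact: cvg_snd.
    by apply: cvgD; [exact: cvg_fst|exact: cvg_cst].
  exact: (cvg_comp _ _ H (fc _)).
have tc (s : R) (x : 'rV[R]_n) (g : R * 'rV[R]_n -> R) : continuous g ->
    {for (s, x), continuous (fun p : R * 'rV[R]_n => g (t, p.2))}.
  move=> gc; have H : (t, p.2) @[p --> (s, x)] --> (t, x).
    by apply: cvg_pairE; [exact: cvg_cst|exact: cvg_snd].
  exact: (cvg_comp _ _ H (gc _)).
have rhoc : continuous rho.
  move=> [s x]; have [->|s0] := eqVneq s 0.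
    apply/cvgrPdist_le => e e0; rewrite /rho/= eqxx.
    have /cvgrPdist_le /(_ e e0) := qc (t, x).
    case=> -[A B] /= [/nbhs_ballP[d /= d0 dA] Bx] AB.
    near=> p.
    have pB : B p.2.
      by near: p; exists (setT, B) => /=; [split=> //; exact: filterT|move=> ? []].
    have pd : `|p.1| < d.
      near: p; exists (ball 0 d, setT) => /=.
        by split; [exact: nbhsx_ballx|exact: filterT].
      by move=> y [/= + _]; rewrite /ball/= sub0r normrN.
    case: ifPn => [_|p0].
      by apply: (AB (t, p.2)); split => //=; apply: dA; exact: ballxx.
    (* The quotient equals [q] at an intermediate time [c], which is as close to [t] as the
       increment is small; joint continuity of [q] concludes. *)
    have [c cp ->] := @mvt_abs (fun t => f (t, p.2)) (fun t => q (t, p.2)) t (p.1 + t)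
      (fun t _ => fd t p.2).
    rewrite addrK mulrCA mulVf// mulr1.
    apply: (AB (c, p.2)); split => //=; apply: dA.
    by rewrite /ball/= distrC (le_lt_trans cp)// addrK.
  have sN : \forall p \near (s, x), p.1 != 0.
    exists ([set y | y != 0], setT) => /=; last by move=> ? [].
    split; last exact: filterT.
    by apply: open_nbhs_nbhs; split => //; exact: open_neq.
  have E : {near (s, x), (fun p : R * 'rV[R]_n =>
      p.1^-1 * (f (p.1 + t, p.2) - f (t, p.2))) =1 rho}.
    by near=> p; rewrite /rho ifN//; near: p.
  apply: (cvg_trans (near_eq_cvg E)); rewrite /rho/= ifN//.
  apply: cvgM; last by apply: cvgB; [exact: sc|exact: (tc s x f)].
  by apply: cvgV => //; exact: cvg_fst.
have cont := @iintegral_param_continuous R n R L rho L0 rhoc _.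
apply: is_deriveE.
have E : {near 0^', (fun h => iintegral (fun x => rho (h, x))) =1
  (fun h => h^-1 *: (iintegral (fun x => f (h *: (1:R) + t, x)) -
                     iintegral (fun x => f (t, x))))}.
  near=> h.
  have h0 : h != 0 by near: h; exact: nbhs_dnbhs_neq.
  have fcc s : Cc_ball L (fun x => f (s, x)).
    split; last exact: f0.
    move=> x; have H : (s, y) @[y --> x] --> (s, x).
      by apply: (@cvg_pairE _ (nbhs x) _ _ _ (fun=> s) id); [exact: cvg_cst|exact: cvg_id].
    exact: (cvg_comp _ _ H (fc _)).
  rewrite -[_ *: _]/(_ * _) -mulN1r -(iintegralZ _ L0)//.
  rewrite -(iintegralD L0)//; last exact: Cc_ballZ.
  rewrite -(iintegralZ _ L0)//; last by apply: Cc_ballD => //; exact: Cc_ballZ.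
  congr iintegral; apply/funext => x; rewrite /rho/= ifN//.
  by rewrite mulN1r [h *: 1]mulr1.
apply: (cvg_trans (near_eq_cvg E)).
have -> : (fun x => q (t, x)) = (fun x => rho (0, x)).
  by apply/funext => x; rewrite /rho/= eqxx.
apply: cvg_within_filter; apply: cont.
move=> s x Lx; rewrite /rho/= !f0// q0// subrr mulr0.
by case: ifP.
Unshelve. all: by end_near. Qed.

(* [iintegral (f (x + s v))] does not depend on [s]; its derivative at [s = 0] is
   [iintegral q].  The shift is reparametrized by [s = sin t] so that the
   supports of the shifted functions stay uniformly bounded. *)
Lemma iintegral_derive0 n L (f q : 'rV[R]_n -> R) v : 0 <= L ->
  Cc_ball L f -> Cc_ball L q -> (forall x, is_derive x v f (q x)) -> iintegral q = 0.
Proof.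
move=> L0 [fc f0] [qc q0] fd.
pose y (p : R * 'rV[R]_n) := sin p.1 *: v + p.2.
have yc : continuous y.
  move=> p; apply: cvgD; last exact: cvg_snd.
  apply: cvgZr_tmp.
  by apply: (@cvg_comp _ _ _ fst sin (nbhs p) (nbhs p.1)); [exact: cvg_fst|exact: continuous_sin].
have yL t x : L + `|v| < `|x| -> L < `|y (t, x)|.
  move=> Lx; rewrite /y/=.
  have : `|x| <= `|sin t *: v + x| + `|sin t *: v|.
    by rewrite -[x in leLHS](addKr (sin t *: v)) addrC; exact: ler_normB.
  have : `|sin t *: v| <= `|v|.
    by rewrite normrZ ler_piMl// ler_norml sin_geN1 sin_le1.
  lra.
have H := @is_derive_iintegral n (L + `|v|) (f \o y)
  (fun p => cos p.1 * q (y p)) 0.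
have [||||||] // := H.
- by rewrite addr_ge0.
- by move=> p; exact: (cvg_comp _ _ (yc p) (fc _)).
- move=> p; apply: cvgM; last exact: (cvg_comp _ _ (yc p) (qc _)).
  by apply: (@cvg_comp _ _ _ fst cos (nbhs p) (nbhs p.1)); [exact: cvg_fst|exact: continuous_cos].
- by move=> t x Lx; rewrite /= f0//; exact: yL.
- by move=> t x Lx; rewrite /= q0 ?mulr0//; exact: yL.
- move=> t x; rewrite /y/= mulrC.
  apply: (@is_derive1_comp R (fun s => f (s *: v + x)) sin t).
  by apply: is_derive_line; exact: fd.
rewrite (_ : (fun t => _) = cst (iintegral f)); last first.
  apply/funext => t; rewrite -(iintegral_shift (sin t *: v) L0 (conj fc f0)).
  by congr iintegral; apply/funext => x; rewrite /= addrC.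
rewrite (_ : (fun x => _) = q); last first.
  by apply/funext => x; rewrite /y/= cos0 sin0 scale0r add0r mul1r.
by rewrite derive_cst => _ <-.
Unshelve. all: by end_near. Qed.

(** Near [a] the function stays above [f a / 2], and the integral over a short interval starting at
    [a] is already positive. This serves to normalise the bump function. *)
Lemma Rintegral_gt0 (L : R) (f : R -> R) a : continuous f ->
  (forall x, L < `|x| -> f x = 0) -> (forall x, 0 <= f x) -> 0 < f a ->
  0 < \int[leb]_x f x.
Proof.
move=> fc f0 fge fa.
have /cvgrPdist_le /(_ (f a / 2)) := fc a.
case; first by rewrite divr_gt0.
move=> d /= d0 dP.
have If := Cc_integrable measurableT fc f0.
have mI : measurable (`[a, a + d / 2] : set R) by exact: measurable_itv.
have dI : {in `[a, a + d / 2]%classic, forall x, f a / 2 <= f x}.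
  move=> x; rewrite inE/= in_itv/= => /andP[h1 h2].
  have /= := dP x; rewrite distrC ger0_norm ?subr_ge0//.
  have xd : x - a < d by lra.
  move=> /(_ xd); rewrite ler_norml; lra.
have : f a / 2 * (d / 2) <= \int[leb]_(x in `[a, a + d / 2]) f x.
  have -> : f a / 2 * (d / 2) = \int[leb]_(x in `[a, a + d / 2]) (f a / 2).
    rewrite Rintegral_cst// [X in fine X]lebesgue_measure_itv /= lte_fin.
    by rewrite ltrDl divr_gt0//= addrAC subrr add0r.
  apply: le_Rintegral => //.
  - apply: continuous_compact_integrable; first exact: segment_compact.
    by apply: continuous_subspaceT; exact: cst_continuous.
  - exact: (integrableS measurableT).
  - by move=> x xI; apply: dI; rewrite inE.
have : 0 < f a / 2 * (d / 2) by rewrite mulr_gt0 // divr_gt0.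
move=> h /(lt_le_trans h) {}h; apply: (lt_le_trans h).
rewrite Rintegral_mkcond; apply: le_Rintegral => //.
  rewrite -restrict_EFin; apply/(integrable_mkcond _ _).1 => //.
  exact: (integrableS measurableT).
by move=> x _; rewrite patchE; case: ifP.
Qed.

Lemma iintegral_ge0 n (f : 'rV[R]_n -> R) :
  (forall x, 0 <= f x) -> 0 <= iintegral f.
Proof.
elim: n f => [|n IH] f f0; first exact: f0.
by rewrite iintegralS; apply: Rintegral_ge0 => x _; exact: IH.
Qed.

Lemma iintegral_gt0 n L (f : 'rV[R]_n -> R) a : 0 <= L -> Cc_ball L f ->
  (forall x, 0 <= f x) -> 0 < f a -> 0 < iintegral f.
Proof.
move=> L0; elim: n f a => [|n IH] f a cf f0 fa.
  by rewrite /= -(thinmx0 a).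
have aE : a = cons_rv (a 0 ord0) (\row_j a 0 (lift ord0 j)).
  apply/rowP => j; case: (unliftP ord0 j) => [k|] ->.
    by rewrite cons_rvS mxE.
  by rewrite cons_rv0.
have [gc g0] := Cc_iintegral_cons L0 cf.
rewrite iintegralS; apply: (Rintegral_gt0 (a := a 0 ord0) gc g0).
  by move=> x; exact: iintegral_ge0.
apply: (IH _ (\row_j a 0 (lift ord0 j))); first exact: Cc_ball_cons.
  by move=> x; exact: f0.
by rewrite -aE.
Qed.

End DerivativeUnderIntegral.

(** * Derivatives of determinants and symmetry of second derivatives *)

Section Calculus.
Variable R : realType.

(** The mean value theorem is applied along [v] to the difference of [f] at two points [h *: w]
    apart, then along [w] to ['D_v f]. Exchanging [v] and [w] expresses the same second difference
    by the other mixed derivative. *)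
Lemma rectangle_mvt (V : normedModType R) (f : V -> R) (x v w : V) h :
  (forall s t, `|s| <= `|h| -> `|t| <= `|h| ->
    derivable f (s *: v + (t *: w + x)) v /\
    derivable ('D_v f) (t *: w + (s *: v + x)) w) ->
  exists s t, [/\ `|s| <= `|h|, `|t| <= `|h| &
    f (h *: v + (h *: w + x)) - f (h *: w + x) - (f (h *: v + x) - f x) =
    'D_w ('D_v f) (t *: w + (s *: v + x)) * h ^+ 2].
Proof.
move=> fd.
have [|s] := @mvt_abs R (fun s => f (s *: v + (h *: w + x)) - f (s *: v + x))
  (fun s => 'D_v f (s *: v + (h *: w + x)) - 'D_v f (s *: v + x)) 0 h.
  move=> s; rewrite !subr0 => sh; apply: is_deriveB.
    by apply: is_derive_line; apply/derivableP; exact: (fd s h sh (lexx _)).1.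
  have H : derivable f (s *: v + x) v.
    have h0 : `|0 : R| <= `|h| by rewrite normr0.
    by have [+ _] := fd s 0 sh h0; rewrite scale0r add0r.
  by apply: is_derive_line; apply/derivableP.
rewrite !subr0 !scale0r !add0r => sh E.
have [|t] := @mvt_abs R (fun t => 'D_v f (t *: w + (s *: v + x)))
  (fun t => 'D_w ('D_v f) (t *: w + (s *: v + x))) 0 h.
  move=> t; rewrite !subr0 => th.
  by apply: (@is_derive_line _ _ _ ('D_v f)); apply/derivableP; exact: (fd s t sh th).2.
rewrite !subr0 !scale0r !add0r => th E2.
exists s, t; split => //.
have -> : f (h *: v + (h *: w + x)) - f (h *: w + x) - (f (h *: v + x) - f x) =
  f (h *: v + (h *: w + x)) - f (h *: v + x) - (f (h *: w + x) - f x) by ring.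
rewrite E.
have -> : s *: v + (h *: w + x) = h *: w + (s *: v + x) by rewrite addrCA.
by rewrite E2; ring.
Qed.

(* Both mixed derivatives are limits of the same second difference over a
   shrinking parallelogram. *)
Lemma derive_comm (V : normedModType R) (f : V -> R) (x v w : V) :
  (\forall y \near x, [/\ derivable f y v, derivable f y w,
     derivable ('D_v f) y w & derivable ('D_w f) y v]) ->
  {for x, continuous ('D_w ('D_v f))} ->
  {for x, continuous ('D_v ('D_w f))} ->
  'D_w ('D_v f) x = 'D_v ('D_w f) x.
Proof.
move=> fd c1 c2.
apply/eqP; rewrite -subr_eq0 -normr_le0; apply/ler_addgt0Pl => e e0.
rewrite addr0.
have e2 : 0 < e / 2 by rewrite divr_gt0.
have N1 := (cvgrPdist_le _ _).1 c1 _ e2.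
have N2 := (cvgrPdist_le _ _).1 c2 _ e2.
have FF : Filter (nbhs x) by exact: nbhs_filter.
have FI := @filterI _ _ FF _ _ fd (@filterI _ _ FF _ _ (N1 FF) (N2 FF)).
have [d /= d0 dP] := (nbhs_normP x _).1 FI.
(* Keeps the whole parallelogram with sides [h *: v] and [h *: w] inside the ball of radius [d],
   even when both vectors are 0. *)
pose h := d / (`|v| + `|w| + 1).
have N0 : 0 < `|v| + `|w| + 1 by rewrite ltr_wpDl// addr_ge0.
have h0 : 0 < h by rewrite divr_gt0.
have inb s t a : `|s| <= `|h| -> `|t| <= `|h| -> a = s *: v + (t *: w + x) ->
    ball_ Num.norm x d a.
  move=> sh th ->; rewrite /ball_/= addrA opprD addrCA subrr addr0 opprD.
  rewrite (le_lt_trans (ler_normD _ _))// !normrN !normrZ.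
  apply: (@le_lt_trans _ _ (h * `|v| + h * `|w|)).
    rewrite (gtr0_norm h0) in sh th.
    by rewrite lerD// ler_wpM2r.
  by rewrite -mulrDr /h mulrAC ltr_pdivrMr// ltr_pM2l// ltrDl.
have [|s [t [sh th E]]] := @rectangle_mvt V f x v w h.
  move=> s t sh th; split.
    by have [[]] := dP _ (inb s t _ sh th erefl).
  by have [[]] := dP (t *: w + (s *: v + x)) (inb s t _ sh th (addrCA _ _ _)).
have [|t' [s' [th' sh' E']]] := @rectangle_mvt V f x w v h.
  move=> s' t' sh' th'; split.
    by have [[]] := dP (s' *: w + (t' *: v + x)) (inb t' s' _ th' sh' (addrCA _ _ _)).
  by have [[]] := dP _ (inb t' s' _ th' sh' erefl).
have [_ [D1 _]] := dP _ (inb s t (t *: w + (s *: v + x)) sh th (addrCA _ _ _)).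
have [_ [_ D2]] := dP _ (inb s' t' (s' *: v + (t' *: w + x)) sh' th' erefl).
have cancel_rect (p q r u a b k : R) : p - q - (r - u) = a * k ->
    p - r - (q - u) = b * k -> k != 0 -> a = b.
  by move=> E1 E2 k0; apply: (@mulIf _ k) => //; rewrite -E1 -E2; ring.
have tri (a b c : R) : `|a - c| <= e / 2 -> `|b - c| <= e / 2 -> `|a - b| <= e.
  move=> ac bc; have -> : a - b = (a - c) - (b - c) by ring.
  by rewrite (splitr e) (le_trans (ler_normB _ _))// lerD.
have h2 : h ^+ 2 != 0 by rewrite expf_neq0// gt_eqF.
rewrite (addrCA (h *: w) (h *: v) x) in E'.
have EE := cancel_rect _ _ _ _ _ _ _ E E' h2.
by rewrite EE in D1; exact: tri D1 D2.
Qed.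

Lemma is_derive_prod (V : normedModType R) n (f : 'I_n -> V -> R) (df : 'I_n -> R)
    x v : (forall i, is_derive x v (f i) (df i)) ->
  is_derive x v (fun y => \prod_(i < n) f i y)
    (\sum_(j < n) \prod_(i < n) (if i == j then df i else f i x)).
Proof.
elim: n f df => [|n IH] f df fd.
  rewrite big_ord0 (_ : (fun y => _) = cst 1); first exact: is_derive_cst.
  by apply/funext => y; rewrite big_ord0.
rewrite (_ : (fun y => _) = f ord0 * (fun y => \prod_(i < n) f (lift ord0 i) y));
  last by apply/funext => y; rewrite big_ord_recl.
have H := IH (fun i => f (lift ord0 i)) (fun i => df (lift ord0 i))
  (fun i => fd (lift ord0 i)).
have K := is_deriveM (fd ord0) H.
apply: (is_derive_eq K).
rewrite [RHS]big_ord_recl addrC; congr (_ + _).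
  by rewrite [RHS]big_ord_recl /= mulrC.
rewrite /GRing.scale/= mulr_sumr; apply: eq_bigr => j _.
by rewrite [RHS]big_ord_recl /=.
Qed.

Lemma is_derive_coord (V : normedModType R) m n (f : V -> 'M[R]_(m, n)) x v df i j :
  is_derive x v f df -> is_derive x v (fun y => f y i j) (df i j).
Proof.
move=> [fd <-]; apply: DeriveDef; first by have /derivable_mxP := fd.
by rewrite derive_mx// mxE.
Qed.

Lemma is_derive_det (V : normedModType R) n (M : 'I_n -> V -> 'rV[R]_n)
    (dM : 'I_n -> 'rV[R]_n) x v : (forall i, is_derive x v (M i) (dM i)) ->
  is_derive x v (fun y => \det (\matrix_i M i y))
    (\sum_k \det (\matrix_i (if i == k then dM i else M i x))).
Proof.
move=> Md.
pose P s y := \prod_(i < n) M i y 0 (s i).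
pose dP s := \sum_(k < n) \prod_(i < n) (if i == k then dM i 0 (s i) else M i x 0 (s i)).
have Pd (s : 'S_n) : is_derive x v (P s) (dP s).
  exact: (is_derive_prod (fun i => is_derive_coord 0 (s i) (Md i))).
have big_is_derive (I : Type) (l : seq I) (F : I -> V -> R) dF :
    (forall i, is_derive x v (F i) (dF i)) ->
    is_derive x v (fun y => \sum_(i <- l) F i y) (\sum_(i <- l) dF i).
  move=> Fd; rewrite (_ : (fun y => _) = \sum_(i <- l) F i).
    by elim/big_ind2 : _ => // [|] *; [exact: is_derive_cst|exact: is_deriveD].
  by apply/funext => y; rewrite fct_sumE.
rewrite (_ : (fun y => _) = (fun y => \sum_(s : 'S_n) (-1) ^+ s * P s y)); last first.
  apply/funext => y; rewrite /determinant; apply: eq_bigr => s _ /=.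
  by congr (_ * _); apply: eq_bigr => i _; rewrite mxE.
have H := big_is_derive _ (index_enum {perm 'I_n}) (fun s => (-1) ^+ s *: P s)
  (fun s => (-1) ^+ s *: dP s) (fun s => is_deriveZ _ (Pd s)).
apply: (is_derive_eq H).
rewrite /determinant exchange_big /=; apply: eq_bigr => s _.
rewrite /GRing.scale/= mulr_sumr; apply: eq_bigr => k _; congr (_ * _).
by apply: eq_bigr => i _; rewrite mxE; case: ifP.
Qed.

End Calculus.

Section RowCalculus.
Variable R : realType.

Lemma is_derive_of_line (V W : normedModType R) (f : V -> W) a v df :
  is_derive (0 : R) (1 : R) (fun t => f (t *: v + a)) df -> is_derive a v f df.
Proof.
move=> [fd <-].
have E : (fun h : R => h^-1 *: (f (h *: v + a) - f a)) =
    (fun h => h^-1 *: (f ((h *: 1 + 0) *: v + a) - f (0 *: v + a))).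
  by apply/funext => h; rewrite [h *: 1]mulr1 addr0 scale0r add0r.
by apply: is_deriveE; rewrite E; exact: fd.
Qed.

(** [F] has only a directional derivative. The chain rule is therefore applied on the line through
    [x] along [v], where derivable and differentiable coincide. *)
Lemma is_derive_comp_diff (V W U : normedModType R) (F : V -> W) (phi : W -> U)
    x v dF : differentiable phi (F x) -> is_derive x v F dF ->
  is_derive x v (fun y => phi (F y)) ('d phi (F x) dF).
Proof.
move=> phid Fd; apply: is_derive_of_line.
pose l (h : R) := F (h *: v + x).
have ld : is_derive (0 : R) (1 : R) l dF.
  by apply: is_derive_line; rewrite scale0r add0r.
have ldiff : differentiable l 0 by apply/derivable1_diffP; exact: ex_derive.
have l0 : l 0 = F x by rewrite /l scale0r add0r.
have phid' : differentiable phi (l 0) by rewrite l0.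
have cd : differentiable (phi \o l) 0 by exact: differentiable_comp.
apply: DeriveDef; first exact: diff_derivable.
have dl : 'd l 0 1 = dF by rewrite -deriveE//; exact: derive_val.
by rewrite -[LHS]/('D_1 (phi \o l) 0) deriveE// diff_comp//= l0 dl.
Qed.

Lemma cvg_prod_ord (T : Type) (F : set_system T) {FF : Filter F} n
    (f : 'I_n -> T -> R) (l : 'I_n -> R) :
  (forall i, f i t @[t --> F] --> l i) ->
  \prod_(i < n) f i t @[t --> F] --> \prod_(i < n) l i.
Proof.
elim: n f l => [|n IH] f l fl.
  under eq_fun do rewrite big_ord0; rewrite big_ord0; exact: cvg_cst.
under eq_fun do rewrite big_ord_recl; rewrite big_ord_recl.
by apply: cvgM; [exact: fl|exact: IH].
Qed.

Lemma cvg_sum_seq (T : Type) (F : set_system T) {FF : Filter F} (I : Type)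
    (s : seq I) (f : I -> T -> R) (l : I -> R) :
  (forall i, f i t @[t --> F] --> l i) ->
  \sum_(i <- s) f i t @[t --> F] --> \sum_(i <- s) l i.
Proof.
move=> fl; elim: s => [|i s IH].
  under eq_fun do rewrite big_nil; rewrite big_nil; exact: cvg_cst.
under eq_fun do rewrite big_cons; rewrite big_cons.
by apply: cvgD; [exact: fl|exact: IH].
Qed.

Lemma cvg_det (T : Type) (F : set_system T) {FF : Filter F} n
    (M : 'I_n -> T -> 'rV[R]_n) (N : 'I_n -> 'rV[R]_n) :
  (forall i, M i t @[t --> F] --> N i) ->
  \det (\matrix_i M i t) @[t --> F] --> \det (\matrix_i N i).
Proof.
move=> MN; apply: cvg_sum_seq => s; apply: cvgM; first exact: cvg_cst.
apply: cvg_prod_ord => i; rewrite mxE; under eq_fun do rewrite mxE.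
exact: cvg_coord.
Qed.

Lemma det_row_subst n (M : 'M[R]_n) (u : 'rV[R]_n) i :
  \det (\matrix_j (if j == i then u else row j M)) = (u *m \adj M) 0 i.
Proof.
rewrite (expand_det_row _ i) mxE; apply: eq_bigr => j _.
rewrite !mxE eqxx; congr (_ * _).
rewrite /cofactor; congr (_ * \det _).
apply/matrixP => a b; rewrite !mxE.
by rewrite eq_sym (negbTE (neq_lift _ _)) mxE.
Qed.

(** Both sides are the entry of [u *m \adj M *m M *m p^T], since [\adj M *m M] is the scalar matrix
    of [\det M]. It will be used with [M] the Jacobian matrix, [p] the gradient of [phi] and [u] the
    direction of deformation. *)
Lemma cramer_sum n (M : 'M[R]_n) (u p : 'rV[R]_n) :
  \sum_i (\sum_l M i l * p 0 l) * \det (\matrix_j (if j == i then u else row j M)) =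
  (\sum_l u 0 l * p 0 l) * \det M.
Proof.
transitivity ((u *m \adj M *m M *m p^T) 0 0).
  rewrite -(mulmxA _ M) mxE; apply: eq_bigr => i _; rewrite det_row_subst mulrC.
  by congr (_ * _); rewrite mxE; apply: eq_bigr => l _; rewrite mxE.
rewrite -(mulmxA u) mul_adj_mx mul_mx_scalar -scalemxAl mxE mulrC; congr (_ * _).
by rewrite mxE; apply: eq_bigr => l _; rewrite mxE.
Qed.

Lemma det_swap_rows n (v : 'I_n -> 'rV[R]_n) (i1 i2 : 'I_n) : i1 != i2 ->
  \det (\matrix_i v (tperm i1 i2 i)) = - \det (\matrix_i v i).
Proof.
move=> i12.
have -> : \matrix_i v (tperm i1 i2 i) = tperm_mx i1 i2 *m (\matrix_i v i).
  by rewrite -xrowE; apply/matrixP => i j; rewrite !mxE.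
by rewrite det_mulmx det_perm odd_tperm i12 expr1 mulN1r.
Qed.

Lemma sum_antisym n (B : 'I_n -> 'I_n -> R) :
  (forall i j, i != j -> B i j = - B j i) ->
  \sum_i \sum_(j | j != i) B i j = 0.
Proof.
move=> Bij; set S := LHS.
have SE : S = - S.
  rewrite {1}/S (exchange_big_dep predT) //= -sumrN; apply: eq_bigr => i _.
  rewrite -sumrN; apply: eq_big => [j|j]; first by rewrite eq_sym.
  by rewrite eq_sym => ij; rewrite Bij// eq_sym.
have : S *+ 2 == 0 by rewrite mulr2n {1}SE addNr.
by rewrite mulrn_eq0 /= => /eqP.
Qed.

Lemma near_eq_continuous n (f g : 'rV[R]_n -> R) (x : 'rV[R]_n) :
  {near x, f =1 g} -> {for x, continuous f} -> {for x, continuous g}.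
Proof.
move=> fg fc; rewrite /prop_for /continuous_at -(nbhs_singleton fg).
exact: cvg_trans (near_eq_cvg fg) fc.
Qed.

Lemma entry_continuous m n (M : 'rV[R]_m -> 'rV[R]_n) x k :
  {for x, continuous M} -> {for x, continuous (fun y => M y 0 k)}.
Proof. by move=> Mc; exact: (cvg_comp _ _ Mc (@coord_continuous R 1 n 0 k (M x))). Qed.

Lemma derive_comm_rV n (f : 'rV[R]_n -> R) (x v w : 'rV[R]_n) :
  (\forall y \near x, [/\ derivable f y v, derivable f y w,
     derivable ('D_v f) y w & derivable ('D_w f) y v]) ->
  {for x, continuous ('D_w ('D_v f))} ->
  {for x, continuous ('D_v ('D_w f))} ->
  'D_w ('D_v f) x = 'D_v ('D_w f) x.
Proof. exact: derive_comm. Qed.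

Lemma open_near n (A : set 'rV[R]_n) x : open A -> A x ->
  \forall y \near x, A y.
Proof. by move=> oA Ax; apply: open_nbhs_nbhs. Qed.

Definition unit_rv n (i : 'I_n) : 'rV[R]_n := delta_mx 0 i.

(** Partial derivatives are carried as functions, with the symmetry of the second ones, so that
    linear combinations of maps act on the data componentwise. *)
Definition C2_data n (A : set 'rV[R]_n) (g : 'rV[R]_n -> 'rV[R]_n)
    (dg : 'I_n -> 'rV[R]_n -> 'rV[R]_n)
    (ddg : 'I_n -> 'I_n -> 'rV[R]_n -> 'rV[R]_n) :=
  forall x, A x -> [/\ {for x, continuous g},
    forall i, {for x, continuous (dg i)} /\ is_derive x (unit_rv i) g (dg i x),
    forall i j, {for x, continuous (ddg i j)} /\
      is_derive x (unit_rv j) (dg i) (ddg i j x) &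
    forall i j, ddg i j x = ddg j i x].

Lemma class_C2_data n (A : set 'rV[R]_n) (g : 'rV[R]_n -> 'rV[R]_n) :
  open A -> class_C 2 A g ->
  C2_data A g (fun i => 'D_(unit_rv i) g)
    (fun i j => 'D_(unit_rv j) ('D_(unit_rv i) g)).
Proof.
move=> oA [gd gd2] x Ax.
have D1 v y : A y -> derivable g y v by move=> /gd; exact: diff_derivable.
have D2 v w y : A y -> derivable ('D_v g) y w.
  by move=> Ay; apply: diff_derivable; exact: (gd2 v).1.
split.
- by apply: differentiable_continuous; exact: gd.
- move=> i; split; last by apply/derivableP; exact: D1.
  by apply: differentiable_continuous; exact: (gd2 _).1.
- move=> i j; split; last by apply/derivableP; exact: D2.
  exact: (gd2 _).2.
- move=> i j; apply/rowP => k.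
  move: (unit_rv i) (unit_rv j) => v w.
  (* Schwarz's theorem is available for scalar functions, so one coordinate is isolated. Derivatives
     of [g] and of [gk] are compared on [A] only, whence the passages to a neighbourhood. *)
  pose gk y := g y 0 k.
  have Dc u y : A y -> 'D_u g y 0 k = 'D_u gk y.
    by move=> Ay; rewrite (derive_mx (D1 u y Ay)) mxE.
  have Dc2 u u' y : A y -> 'D_u' ('D_u g) y 0 k = 'D_u' ('D_u gk) y.
    move=> Ay; rewrite (derive_mx (D2 u u' y Ay)) mxE.
    by apply: near_eq_derive; near=> z; apply: Dc; near: z; exact: open_near.
  have Dd u u' y : A y -> derivable ('D_u gk) y u'.
    move=> Ay; apply: (@near_eq_derivable _ _ _ (fun z => 'D_u g z 0 k)).
      by near=> z; apply: Dc; near: z; exact: open_near.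
    by have /derivable_mxP := D2 u u' y Ay.
  have Dcont u u' : {for x, continuous ('D_u' ('D_u gk))}.
    apply: (@near_eq_continuous _ (fun z => 'D_u' ('D_u g) z 0 k)).
      by near=> z; apply: Dc2; near: z; exact: open_near.
    have K := @entry_continuous n n ('D_u' ('D_u g)) x k ((gd2 u).2 u' x Ax).
    exact: K.
  apply: (etrans (Dc2 v w x Ax)); apply: etrans (esym (Dc2 w v x Ax)).
  apply: derive_comm_rV; [|exact: Dcont|exact: Dcont].
  near=> y.
  have Ay : A y by near: y; exact: open_near.
  split; [| |exact: Dd|exact: Dd].
    by have /derivable_mxP H := D1 v y Ay; exact: H.
  by have /derivable_mxP H := D1 w y Ay; exact: H.
Unshelve. all: by end_near. Qed.

Lemma C2_dataB n (A : set 'rV[R]_n) g dg ddg h dh ddh :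
  C2_data A g dg ddg -> C2_data A h dh ddh ->
  C2_data A (fun x => g x - h x) (fun i x => dg i x - dh i x)
    (fun i j x => ddg i j x - ddh i j x).
Proof.
move=> Cg Ch x Ax; have [g0 g1 g2 g3] := Cg x Ax; have [h0 h1 h2 h3] := Ch x Ax.
split.
- exact: (cvgB g0 h0).
- move=> i; split; first exact: (cvgB (g1 i).1 (h1 i).1).
  exact: (@is_deriveB _ _ _ _ _ _ _ _ _ (g1 i).2 (h1 i).2).
- move=> i j; split; first exact: (cvgB (g2 i j).1 (h2 i j).1).
  exact: (@is_deriveB _ _ _ _ _ _ _ _ _ (g2 i j).2 (h2 i j).2).
- by move=> i j; rewrite g3 h3.
Qed.

End RowCalculus.

(** * Homotopy invariance of the degree integral *)

Section HomotopyInvariance.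
Variables (R : realType) (n : nat).
Local Notation rV := 'rV[R]_n.

Lemma derive_sum_coord (phi : rV -> R) (y u : rV) : differentiable phi y ->
  'd phi y u = \sum_l u 0 l * 'D_(unit_rv R l) phi y.
Proof.
move=> phid; rewrite {1}[u]row_sum_delta linear_sum; apply: eq_bigr => l _.
by rewrite linearZ deriveE.
Qed.

Lemma is_derive_comp_coord (V : normedModType R) (F : V -> rV) (phi : rV -> R)
    x v dF : differentiable phi (F x) -> is_derive x v F dF ->
  is_derive x v (fun y => phi (F y))
    (\sum_l dF 0 l * 'D_(unit_rv R l) phi (F x)).
Proof.
move=> phid Fd; rewrite -derive_sum_coord//.
exact: is_derive_comp_diff.
Qed.

Definition detr (v : 'I_n -> rV) : R := \det (\matrix_i v i).

Variables (A : set rV) (phi : rV -> R) (r : R).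
Variables (g k : rV -> rV) (dg dk : 'I_n -> rV -> rV).
Variables (ddg ddk : 'I_n -> 'I_n -> rV -> rV).
Hypotheses (oA : open A) (phiC : class_C 1 setT phi).
Hypothesis phi0 : forall z, r < `|z| -> phi z = 0.
Hypotheses (Cg : C2_data A g dg ddg) (Ck : C2_data A k dk ddk).

Definition seg (p : R * rV) : rV := g p.2 + p.1 *: k p.2.
Definition segr (p : R * rV) i : rV := dg i p.2 + p.1 *: dk i p.2.
Definition segrr (p : R * rV) i j : rV := ddg i j p.2 + p.1 *: ddk i j p.2.
Definition integrand (p : R * rV) : R := phi (seg p) * detr (segr p).
(** Component [i] of the row vector phi(G_s) k adj(DG_s): putting [k] in row [i] of the Jacobian
    computes an entry of the product with the adjugate, as in [det_row_subst]. *)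
Definition flux i (p : R * rV) : R :=
  phi (seg p) * detr (fun j => if j == i then k p.2 else segr p j).
Definition dflux i (p : R * rV) : R :=
  phi (seg p) * (\sum_m detr (fun j => if j == m
       then (if j == i then dk i p.2 else segrr p j i)
       else (if j == i then k p.2 else segr p j))) +
  detr (fun j => if j == i then k p.2 else segr p j) *
  \sum_l segr p i 0 l * 'D_(unit_rv R l) phi (seg p).
Definition dintegrand (p : R * rV) : R :=
  phi (seg p) * (\sum_m detr (fun j => if j == m then dk j p.2 else segr p j)) +
  detr (segr p) * \sum_l k p.2 0 l * 'D_(unit_rv R l) phi (seg p).

Lemma detr_ext (v w : 'I_n -> rV) : v =1 w -> detr v = detr w.
Proof. by move=> /funext ->. Qed.

(* Divergence form of the derivative of [phi (G_s) det DG_s] along the segment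
   [G_s = g + s k]: the terms of the divergence of the flux containing second
   derivatives of [G_s] cancel in pairs, since exchanging two rows of a
   determinant changes its sign, and Cramer's rule gives the derivative of
   [phi]. *)
Lemma dintegrandE p : A p.2 -> dintegrand p = \sum_i dflux i p.
Proof.
move=> Ap; rewrite /dintegrand /dflux big_split /=; congr (_ + _); last first.
  have E u : \sum_l u 0 l * 'D_(unit_rv R l) phi (seg p) =
      \sum_l u 0 l * (\row_l0 'D_(unit_rv R l0) phi (seg p)) 0 l.
    by apply: eq_bigr => l _; rewrite mxE.
  rewrite mulrC E /detr -cramer_sum; apply: eq_bigr => i _.
  rewrite mulrC E; congr (_ * _).
    by congr (\det _); apply/matrixP => a b; rewrite !mxE; case: eqP => // _; rewrite !mxE.
  by apply: eq_bigr => l _; rewrite mxE.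
rewrite -mulr_sumr; congr (_ * _).
(* For [m != i], row [i] holds [k] and row [m] is differentiated in direction [i]; these are the
   terms that cancel. The diagonal terms [T i i] are those of [dintegrand]. *)
pose T i m := detr (fun j => if j == m
       then (if j == i then dk i p.2 else segrr p j i)
       else (if j == i then k p.2 else segr p j)).
rewrite [RHS](eq_bigr (fun i => T i i + \sum_(m | m != i) T i m)); last first.
  by move=> i _; rewrite (bigD1 i).
rewrite big_split /= [X in _ + X]sum_antisym ?addr0.
  apply: eq_bigr => i _; apply: detr_ext => j.
  by case: (eqVneq j i) => [->|].
move=> i j ij; rewrite /T [X in - X]/detr -(det_swap_rows _ ij); apply: detr_ext => m.
have [_ _ _ gs] := Cg Ap; have [_ _ _ ks] := Ck Ap.
case: tpermP => [->|->|].
- by rewrite (eq_sym j) (negbTE ij) !eqxx.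
- by rewrite !eqxx (eq_sym j) (negbTE ij) /segrr gs ks.
- by move=> /eqP/negbTE -> /eqP/negbTE ->.
Qed.

Lemma is_derive_lincomb (V : normedModType R) (x v : V) (u w : V -> rV) du dw s :
  is_derive x v u du -> is_derive x v w dw ->
  is_derive x v (fun y => u y + s *: w y) (du + s *: dw).
Proof. by move=> ud wd; exact: (is_deriveD ud (is_deriveZ s wd)). Qed.

Lemma is_derive_param (W : normedModType R) (u w : W) s :
  is_derive s (1 : R) (fun s : R => u + s *: w) w.
Proof.
apply: is_deriveE.
have E : {near 0^', cst w =1
    (fun h => h^-1 *: (u + (h *: (1 : R) + s) *: w - (u + s *: w)))}.
  near=> h; have h0 : h != 0 by near: h; exact: nbhs_dnbhs_neq.
  rewrite [h *: 1]mulr1 opprD addrACA subrr add0r scalerDl addrK.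
  by rewrite scalerA mulVf// scale1r.
by apply: (cvg_trans (near_eq_cvg E)); exact: cvg_cst.
Unshelve. all: by end_near. Qed.

Lemma phi_diff z : differentiable phi z.
Proof. by case: phiC => + _; exact. Qed.

Lemma is_derive_integrand s x : A x ->
  is_derive s (1 : R) (fun s => integrand (s, x)) (dintegrand (s, x)).
Proof.
move=> Ax.
have H1 := is_derive_comp_coord (phi_diff _) (is_derive_param (g x) (k x) s).
have H2 := is_derive_det (fun i => is_derive_param (dg i x) (dk i x) s).
have H := is_deriveM H1 H2.
exact: H.
Qed.

Lemma is_derive_flux i s x : A x ->
  is_derive x (unit_rv R i) (fun y => flux i (s, y)) (dflux i (s, x)).
Proof.
move=> Ax; have [_ g1 g2 _] := Cg Ax; have [_ k1 k2 _] := Ck Ax.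
have H1 := is_derive_comp_coord (phi_diff _)
  (is_derive_lincomb s (g1 i).2 (k1 i).2).
pose M j (y : rV) := if j == i then k y else segr (s, y) j.
pose dM j := if j == i then dk i x else segrr (s, x) j i.
have MD j : is_derive x (unit_rv R i) (M j) (dM j).
  rewrite /M /dM; case: eqP => [_|_]; first exact: (k1 i).2.
  exact: (is_derive_lincomb s (g2 j i).2 (k2 j i).2).
have H2 := is_derive_det MD.
have H := is_deriveM H1 H2.
exact: H.
Qed.

Lemma phi_cts z : {for z, continuous phi}.
Proof. by apply: differentiable_continuous; exact: phi_diff. Qed.

Lemma dphi_cts v z : {for z, continuous ('D_v phi)}.
Proof. by case: phiC => _ /(_ v z); exact. Qed.

Lemma dphi0 v z : r < `|z| -> 'D_v phi z = 0.
Proof.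
move=> rz; rewrite (@near_eq_derive R _ _ phi (cst 0)) ?derive_cst//.
have : \forall y \near z, r < `|y|.
  apply: (@cvgr_gt R _ (nbhs z) _ (fun y : rV => `|y|) `|z|) => //.
  exact: norm_continuous.
by apply: filterS => y /phi0.
Qed.

Lemma snd_cts (T U : topologicalType) (f : T -> U) (p : R * T) :
  {for p.2, continuous f} -> {for p, continuous (fun q : R * T => f q.2)}.
Proof.
case: p => a b /= fc.
have H : (q.2 : T) @[q --> (a, b)] --> b by exact: cvg_snd.
exact: (cvg_comp _ _ H fc).
Qed.

Lemma lincomb_cts (u w : rV -> rV) (p : R * rV) :
  {for p.2, continuous u} -> {for p.2, continuous w} ->
  {for p, continuous (fun q : R * rV => u q.2 + q.1 *: w q.2)}.
Proof.
move=> uc wc; apply: cvgD; first exact: snd_cts.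
by apply: cvgZ; [exact: cvg_fst|exact: snd_cts].
Qed.

Lemma seg_cts p : A p.2 -> {for p, continuous seg}.
Proof.
by move=> Ap; have [g0 _ _ _] := Cg Ap; have [k0 _ _ _] := Ck Ap; exact: lincomb_cts.
Qed.

Lemma segr_cts p i : A p.2 -> {for p, continuous (segr ^~ i)}.
Proof.
move=> Ap; have [_ g1 _ _] := Cg Ap; have [_ k1 _ _] := Ck Ap.
exact: (lincomb_cts (g1 i).1 (k1 i).1).
Qed.

Lemma segrr_cts p i j : A p.2 -> {for p, continuous (fun q => segrr q i j)}.
Proof.
move=> Ap; have [_ _ g2 _] := Cg Ap; have [_ _ k2 _] := Ck Ap.
exact: (lincomb_cts (g2 i j).1 (k2 i j).1).
Qed.

Lemma comp_seg_cts (f : rV -> R) p : A p.2 -> {for seg p, continuous f} ->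
  {for p, continuous (fun q => f (seg q))}.
Proof. by move=> Ap fc; exact: (cvg_comp _ _ (seg_cts Ap) fc). Qed.

Lemma detr_cts (v : R * rV -> 'I_n -> rV) p :
  (forall i, {for p, continuous (v ^~ i)}) ->
  {for p, continuous (fun q => detr (v q))}.
Proof.
move=> vc; exact: (@cvg_det R _ (nbhs p) _ n (fun i q => v q i) (v p) vc).
Qed.

Lemma integrand_cts p : A p.2 -> {for p, continuous integrand}.
Proof.
move=> Ap; apply: cvgM; first by apply: comp_seg_cts => //; exact: phi_cts.
by apply: detr_cts => i; exact: segr_cts.
Qed.

Lemma flux_rows_cts p i j : A p.2 ->
  {for p, continuous (fun q => if j == i then k q.2 else segr q j)}.
Proof.
move=> Ap; case: (j == i); last exact: segr_cts.
by have [k0 _ _ _] := Ck Ap; exact: snd_cts.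
Qed.

Lemma flux_cts i p : A p.2 -> {for p, continuous (flux i)}.
Proof.
move=> Ap; apply: cvgM; first by apply: comp_seg_cts => //; exact: phi_cts.
by apply: detr_cts => j; exact: flux_rows_cts.
Qed.

Lemma dflux_cts i p : A p.2 -> {for p, continuous (dflux i)}.
Proof.
move=> Ap; apply: cvgD; apply: cvgM.
- by apply: comp_seg_cts => //; exact: phi_cts.
- apply: cvg_sum_seq => m; apply: detr_cts => j.
  case: (j == m); last exact: flux_rows_cts.
  case: (j == i); last exact: segrr_cts.
  by have [_ k1 _ _] := Ck Ap; apply: snd_cts; exact: (k1 i).1.
- by apply: detr_cts => j; exact: flux_rows_cts.
- apply: cvg_sum_seq => l; apply: cvgM.
    exact: (cvg_comp _ _ (segr_cts (i := i) Ap) (@coord_continuous R 1 n 0 l _)).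
  exact: (comp_seg_cts Ap (@dphi_cts (unit_rv R l) (seg p))).
Qed.

Hypothesis bd : forall s x, 0 <= s <= 1 -> closure A x -> ~ A x -> r < `|seg (s, x)|.
Hypotheses (gc : {within closure A, continuous g})
  (kc : {within closure A, continuous k}).

(** Off the closure the conclusion is vacuous nearby. At a boundary point [bd] is a strict
    inequality, and continuity within the closure, all that is known of [g] and [k] there, carries
    it to nearby points of the closure. *)
Lemma near_boundary (p : R * rV) : 0 <= p.1 <= 1 -> ~ A p.2 ->
  \forall q \near p, closure A q.2 -> r < `|seg q|.
Proof.
move=> p01 nAp; have [cAp|ncAp] := pselect (closure A p.2); last first.
  have : \forall y \near p.2, ~ closure A y.
    by apply: open_nbhs_nbhs; split => //; apply: closed_openC; exact: closed_closure.
  move=> H; have H2 : \forall q \near p, ~ closure A q.2 by exact: cvg_snd H.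
  by apply: filterS H2.
pose B : set (R * rV) := [set q | closure A q.2].
have cl f : {within closure A, continuous f} ->
    f q.2 @[q --> within B (nbhs p)] --> (f p.2 : rV).
  move=> /subspace_continuousP /(_ _ cAp) fc.
  apply: cvg_comp fc => W; rewrite /= /within/= => HW.
  have := @cvg_snd _ _ (nbhs p.1) (nbhs p.2) _ _ HW.
  exact.
have segc : seg q @[q --> within B (nbhs p)] --> seg p.
  apply: cvgD; first exact: cl.
  apply: cvgZ; last exact: cl.
  by apply: cvg_within_filter; exact: cvg_fst.
have : \forall q \near within B (nbhs p), r < `|seg q|.
  apply: (cvgr_gt _ (cvg_norm segc)); case: p p01 nAp cAp {cl segc B} => s x /=.
  by move=> *; exact: bd.
by rewrite near_withinE.
Qed.

Lemma near_eq_continuous_pair (f1 f2 : R * rV -> R) (q : R * rV) :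
  (\forall u \near q, f1 u = f2 u) -> {for q, continuous f1} ->
  {for q, continuous f2}.
Proof.
move=> ff fc; rewrite /prop_for /continuous_at -(nbhs_singleton ff).
exact: cvg_trans (near_eq_cvg ff) fc.
Qed.

(* [s = sin t ^ 2] lets [t] range over the whole line while [s] stays in [0, 1],
   where the boundary condition holds. *)
Definition cut (c : R * rV -> R) (q : R * rV) : R :=
  \1_A q.2 * c (sin q.1 ^+ 2, q.2).

Lemma sin2_01 (t : R) : 0 <= sin t ^+ 2 <= 1.
Proof. by rewrite sqr_ge0 -(cos2Dsin2 t) lerDr sqr_ge0. Qed.

Lemma reparam_cvg (q : R * rV) :
  (sin u.1 ^+ 2, u.2) @[u --> q] --> (sin q.1 ^+ 2, q.2).
Proof.
apply: cvg_pairE; last exact: cvg_snd.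
have H : sin u.1 @[u --> q] --> sin q.1.
  by apply: (@cvg_comp _ _ _ fst sin (nbhs q) (nbhs q.1)); [exact: cvg_fst|exact: continuous_sin].
by rewrite expr2; under eq_fun do rewrite expr2; exact: cvgM.
Qed.

(** This makes the indicator harmless: all points of [A] close to the boundary already have [seg]
    beyond [r], so extension by zero creates no singularity. *)
Lemma cut_near0 c (q : R * rV) : (forall p, r < `|seg p| -> c p = 0) -> ~ A q.2 ->
  \forall u \near q, cut c u = 0.
Proof.
move=> c0 nAq.
have := near_boundary (p := (sin q.1 ^+ 2, q.2)) (sin2_01 _) nAq.
move=> HB; have H1 : \forall u \near q, closure A u.2 ->
    r < `|seg (sin u.1 ^+ 2, u.2)| by exact: (reparam_cvg HB).
apply: filterS H1 => u H.
rewrite /cut indicE; case: (boolP (u.2 \in A)) => [|_]; last by rewrite mul0r.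
by rewrite inE => /subset_closure /H /c0 ->; rewrite mulr0.
Qed.

Lemma cut_near c (q : R * rV) : A q.2 ->
  \forall u \near q, c (sin u.1 ^+ 2, u.2) = cut c u.
Proof.
move=> Aq; have H : \forall u \near q, A u.2.
  have AN : \forall y \near q.2, A y by exact: open_nbhs_nbhs.
  have C : (u.2 : rV) @[u --> q] --> q.2 by exact: cvg_snd.
  exact: (C _ AN).
by apply: filterS H => u Au; rewrite /cut indicE mem_set// mul1r.
Qed.

Lemma cut_cts c : (forall p, A p.2 -> {for p, continuous c}) ->
  (forall p, r < `|seg p| -> c p = 0) -> continuous (cut c).
Proof.
move=> ccts c0 q; have [Aq|nAq] := pselect (A q.2); last first.
  apply: (@near_eq_continuous_pair (cst 0)); last exact: cst_continuous.
  by apply: filterS (cut_near0 c0 nAq) => u.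
apply: near_eq_continuous_pair (cut_near c Aq) _.
exact: (cvg_comp _ _ (reparam_cvg (q := q)) (ccts _ _)).
Qed.

Variable L : R.
Hypotheses (L0 : 0 <= L) (AL : forall x, A x -> `|x| <= L).

Lemma cut_support c (t : R) (x : rV) : L < `|x| -> cut c (t, x) = 0.
Proof.
move=> Lx; rewrite /cut indicE memNset ?mul0r//= => /AL.
by rewrite leNgt Lx.
Qed.

Lemma slice_near (P : R * rV -> Prop) (t : R) (x : rV) : (\forall u \near (t, x), P u) ->
  \forall y \near x, P (t, y).
Proof.
move=> H; have C : ((t, y) : R * rV) @[y --> x] --> (t, x).
  by apply: (@cvg_pairE _ (nbhs x) _ _ _ (fun=> t) id); [exact: cvg_cst|exact: cvg_id].
exact: (C _ H).
Qed.

Lemma cut_Cc_ball c t : (forall p, A p.2 -> {for p, continuous c}) ->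
  (forall p, r < `|seg p| -> c p = 0) -> Cc_ball L (fun x => cut c (t, x)).
Proof.
move=> ccts c0; split; last by move=> x; exact: cut_support.
move=> x; have C : ((t, y) : R * rV) @[y --> x] --> (t, x).
  by apply: (@cvg_pairE _ (nbhs x) _ _ _ (fun=> t) id); [exact: cvg_cst|exact: cvg_id].
have K : {for (t, x), continuous (cut c)} := @cut_cts c ccts c0 (t, x).
exact: (cvg_comp _ _ C K).
Qed.

Lemma integrand_out p : r < `|seg p| -> integrand p = 0.
Proof. by move=> rp; rewrite /integrand phi0// mul0r. Qed.

Lemma flux_out i p : r < `|seg p| -> flux i p = 0.
Proof. by move=> rp; rewrite /flux phi0// mul0r. Qed.

Lemma dflux_out i p : r < `|seg p| -> dflux i p = 0.
Proof.
move=> rp; rewrite /dflux phi0// mul0r add0r big1 ?mulr0// => l _.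
by rewrite dphi0// mulr0.
Qed.

Lemma is_derive_cut_flux i (t : R) (x : rV) :
  is_derive x (unit_rv R i) (fun y => cut (flux i) (t, y)) (cut (dflux i) (t, x)).
Proof.
have [Ax|nAx] := pselect (A x); last first.
  have -> : cut (dflux i) (t, x) = 0 by rewrite /cut indicE memNset// mul0r.
  apply: (@near_eq_is_derive R rV R (cst 0)).
  have := slice_near (cut_near0 (q := (t, x)) (@flux_out i) nAx).
  by apply: filterS => y /esym.
have -> : cut (dflux i) (t, x) = dflux i (sin t ^+ 2, x).
  by rewrite /cut indicE mem_set// mul1r.
apply: (@near_eq_is_derive R rV R (fun y => flux i (sin t ^+ 2, y))).
  exact: (slice_near (cut_near (flux i) (q := (t, x)) Ax)).
exact: is_derive_flux.
Qed.

Lemma iintegral_cut_dflux i t : iintegral (fun x => cut (dflux i) (t, x)) = 0.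
Proof.
apply: (iintegral_derive0 L0 _ _ (is_derive_cut_flux i t)).
  by apply: cut_Cc_ball; [exact: flux_cts|exact: flux_out].
by apply: cut_Cc_ball; [exact: dflux_cts|exact: dflux_out].
Qed.

Lemma is_derive_cut_integrand (t : R) (x : rV) :
  is_derive t (1 : R) (fun t => cut integrand (t, x))
    ((cos t * sin t *+ 2) * \sum_i cut (dflux i) (t, x)).
Proof.
rewrite /cut indicE; case: (boolP (x \in A)) => [|_]; last first.
  rewrite big1 ?mulr0; last by move=> i _; rewrite mul0r.
  rewrite (_ : (fun t => _) = cst 0); first exact: is_derive_cst.
  by apply/funext => u; rewrite mul0r.
rewrite inE => Ax.
under eq_bigr do rewrite mul1r; rewrite -dintegrandE// mulrC.
under eq_fun do rewrite mul1r.
apply: (@is_derive1_comp R (fun s => integrand (s, x)) (fun t => sin t ^+ 2) t).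
  exact: is_derive_integrand.
have -> : (fun t : R => sin t ^+ 2) = (@sin R) * (@sin R).
  by apply/funext => u; rewrite expr2.
have H := is_deriveM (is_derive_sin t) (is_derive_sin t).
by apply: (is_derive_eq H); rewrite /GRing.scale/= mulrC mulr2n.
Qed.

(** The values 0 and 1 of [s = sin t ^ 2] are reached at [t = 0] and [t = pi / 2]. In between the
    integral is constant, its derivative being a multiple of the sum of the vanishing integrals of
    [iintegral_cut_dflux]. *)
Lemma iintegral_integrand_homotopy :
  iintegral (fun x => \1_A x * integrand (0, x)) =
  iintegral (fun x => \1_A x * integrand (1, x)).
Proof.
pose I t := iintegral (fun x => cut integrand (t, x)).
have -> : (fun x => \1_A x * integrand (0, x)) = (fun x => cut integrand (0, x)).
  by apply/funext => x; rewrite /cut /= sin0 expr0n.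
have -> : (fun x => \1_A x * integrand (1, x)) = (fun x => cut integrand (pi / 2, x)).
  by apply/funext => x; rewrite /cut /= sin_pihalf expr1n.
apply: (@is_derive_0_is_cst R I) => t.
have Qcc : Cc_ball L (fun x => \sum_i cut (dflux i) (t, x)) /\
    iintegral (fun x => \sum_i cut (dflux i) (t, x)) = 0.
  have [|H1 H2] := iintegral_sum (index_enum 'I_n)
    (f := fun i x => cut (dflux i) (t, x)) L0.
    by move=> i; apply: cut_Cc_ball; [exact: dflux_cts|exact: dflux_out].
  by split => //; rewrite H2 big1// => i _; exact: iintegral_cut_dflux.
have E := iintegralZ (cos t * sin t *+ 2) L0 Qcc.1.
rewrite Qcc.2 mulr0 in E.
have := @is_derive_iintegral R n L (cut integrand)
  (fun p => (cos p.1 * sin p.1 *+ 2) * \sum_i cut (dflux i) p) t L0.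
rewrite /= E; apply.
- by apply: cut_cts; [exact: integrand_cts|exact: integrand_out].
- move=> p.
  have sc (f : R -> R) : continuous f -> f q.1 @[q --> p] --> f p.1.
    by move=> fc; apply: (@cvg_comp _ _ _ fst f (nbhs p) (nbhs p.1)); [exact: cvg_fst|exact: fc].
  apply: cvgM.
    by apply: cvgMn; apply: cvgM; apply: sc; [exact: continuous_cos|exact: continuous_sin].
  by apply: cvg_sum_seq => i; apply: cut_cts; [exact: dflux_cts|exact: dflux_out].
- by move=> u x; exact: cut_support.
- by move=> u x Lx; rewrite big1 ?mulr0// => i _; exact: cut_support.
- by move=> u x; exact: is_derive_cut_integrand.
Qed.

End HomotopyInvariance.

(** * Consequences for the degree integral, and positive lower bounds on compact sets *)

Section DegreeIntegral.
Variables (R : realType) (n : nat).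
Local Notation rV := 'rV[R]_n.

Definition degree_integral (A : set rV) (phi : rV -> R) (g : rV -> rV) : R :=
  iintegral (fun x => \1_A x * (phi (g x) * \det ('J g x))).

Lemma det_jacobian (g : rV -> rV) (x : rV) : differentiable g x ->
  \det ('J g x) = detr (fun i => 'D_(unit_rv R i) g x).
Proof.
move=> gd; congr (\det _); apply/row_matrixP => i.
by rewrite rowK rowE deriveEjacobian.
Qed.

Lemma degree_integral_homotopy (A : set rV) phi r (g0 g1 : rV -> rV) :
  open A -> bounded_set A -> class_C 1 setT phi ->
  (forall z, r < `|z| -> phi z = 0) ->
  class_C 2 A g0 -> class_C 2 A g1 ->
  {within closure A, continuous g0} -> {within closure A, continuous g1} ->
  (forall s x, 0 <= s <= 1 -> closure A x -> ~ A x ->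
    r < `|g0 x + s *: (g1 x - g0 x)|) ->
  degree_integral A phi g0 = degree_integral A phi g1.
Proof.
move=> oA [M [_ AM]] phiC phi0 C0 C1 c0 c1 bd.
(* Boundedness gives a bound only for numbers strictly above [M], and [M] may be negative. *)
pose L := `|M| + 1.
have L0 : 0 <= L by rewrite addr_ge0.
have AL x : A x -> `|x| <= L.
  by apply: AM; rewrite /L (le_lt_trans (ler_norm M))// ltrDl.
have D0 := class_C2_data oA C0; have D1 := class_C2_data oA C1.
have Dk := C2_dataB D1 D0.
have kc : {within closure A, continuous (fun x => g1 x - g0 x)}.
  by move=> x; apply: continuousB; [exact: c1|exact: c0].
have := iintegral_integrand_homotopy oA phiC phi0 D0 Dk bd c0 kc L0 AL.
congr (_ = _); congr iintegral; apply/funext => x; rewrite indicE;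
  case: (boolP (x \in A)) => [|_]; rewrite ?mul0r ?mul1r// inE => Ax.
- rewrite /integrand /seg /= scale0r addr0 det_jacobian; last exact: C0.1.
  by congr (_ * _); apply: detr_ext => i; rewrite /segr /= scale0r addr0.
- rewrite /integrand /seg /= scale1r addrC subrK det_jacobian; last exact: C1.1.
  by congr (_ * _); apply: detr_ext => i; rewrite /segr /= scale1r addrC subrK.
Qed.

Lemma degree_integral_eq0 (A : set rV) phi r (g : rV -> rV) :
  (forall z, r < `|z| -> phi z = 0) -> (forall x, A x -> r < `|g x|) ->
  degree_integral A phi g = 0.
Proof.
move=> phi0 gA; rewrite /degree_integral (_ : (fun x => _) = (fun=> 0)).
  exact: iintegral0.
apply/funext => x; rewrite indicE; case: (boolP (x \in A)) => [|_].
  by rewrite inE => /gA /phi0 ->; rewrite mul0r mulr0.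
by rewrite mul0r.
Qed.

End DegreeIntegral.

Section CompactMin.
Variable R : realType.

(** A minimum is attained unless [K] is empty, in which case 1 is returned. *)
Lemma compact_pos_lbound (T : topologicalType) (K : set T) (f : T -> R) :
  compact K -> {within K, continuous f} -> (forall x, K x -> 0 < f x) ->
  exists2 m, 0 < m & forall x, K x -> m <= f x.
Proof.
move=> cK fc fpos; have [[x Kx]|/set0P/negP/negPn/eqP ->] := pselect (K !=set0).
  have [c cK' cmin] := compact_EVT_min (ex_intro _ x Kx) cK fc.
  exists (f c); first by apply: fpos; rewrite inE in cK'.
  by move=> y Ky; apply: cmin; rewrite inE.
by exists 1.
Qed.

End CompactMin.

(** * Bump functions and functions of class C^k *)

Section Bump.
Variable R : realType.

Lemma is_derive_max0_sqr (s : R) :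
  is_derive s (1 : R) (fun s : R => Num.max 0 s ^+ 2) (2 * Num.max 0 s).
Proof.
have [s0|s0|->] := ltgtP s 0.
- rewrite mulr0.
  apply: (@near_eq_is_derive R R R (cst 0)).
  near=> t; rewrite max_l ?expr0n// ltW//.
  by near: t; exact: lt_nbhsl.
- apply: (@near_eq_is_derive R R R (fun t => t ^+ 2)).
    near=> t; rewrite max_r// ltW//.
    by near: t; exact: lt_nbhsr.
  have H := is_deriveX 2 (is_derive_id s (1 : R)).
  by apply: (is_derive_eq H); rewrite expr1 [LHS]mulr1.
- rewrite mulr0; apply: is_deriveE; apply/cvgrPdist_le => e e0.
  near=> h.
  have h0 : h != 0 by near: h; exact: nbhs_dnbhs_neq.
  have he : `|h| <= e by near: h; exact: dnbhs0_le.
  rewrite [h *: 1]mulr1 addr0 maxxx expr0n subr0 sub0r normrN normrZ normfV.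
  rewrite ler_pdivrMl ?normr_gt0// normrX expr2.
  have : `|Num.max 0 h| <= `|h|.
    by case: (leP 0 h) => // _; rewrite normr0.
  have := normr_ge0 h; have := normr_ge0 (Num.max 0 h); nra.
Unshelve. all: by end_near. Qed.

Variable n : nat.
Local Notation rV := 'rV[R]_n.

Definition sqnorm (z : rV) : R := \sum_i z 0 i ^+ 2.

Lemma is_derive_sqnorm (z v : rV) :
  is_derive z v sqnorm (\sum_i 2 * z 0 i * v 0 i).
Proof.
have cd i : is_derive z v (fun y : rV => y 0 i) (v 0 i).
  exact: (is_derive_coord 0 i (is_derive_id z v)).
have H := is_derive_sum (fun i => is_deriveX 2 (cd i)).
rewrite (_ : sqnorm = \sum_i (fun y : rV => y 0 i) ^+ 2); last first.
  by apply/funext => y; rewrite fct_sumE.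
by apply: (is_derive_eq H); apply: eq_bigr => i _; rewrite expr1.
Qed.

(** The positive part is squared to become of class C^1. The Euclidean square replaces the
    non-smooth sup norm; since it dominates the square of the latter, the support still lies in the
    sup-norm ball of radius [rho]. *)
Definition bump (rho : R) (z : rV) : R := Num.max 0 (rho ^+ 2 - sqnorm z) ^+ 2.

Lemma sqnorm_differentiable z : differentiable sqnorm z.
Proof.
rewrite (_ : sqnorm = \sum_i (fun y : rV => y 0 i) ^+ 2); last first.
  by apply/funext => y; rewrite fct_sumE.
apply: differentiable_sum => i; apply: differentiableX.
exact: differentiable_coord.
Qed.

Lemma bump_C1 rho : class_C 1 setT (bump rho).
Proof.
have rd z : differentiable (fun z => rho ^+ 2 - sqnorm z) z.
  apply: differentiableB; first exact: differentiable_cst.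
  exact: sqnorm_differentiable.
have bd z : differentiable (bump rho) z.
  apply: (@differentiable_comp _ _ _ _ (fun z => rho ^+ 2 - sqnorm z)
    (fun s => Num.max 0 s ^+ 2)) => //.
  apply/derivable1_diffP; exact: (@ex_derive _ _ _ _ _ _ _ (is_derive_max0_sqr _)).
split => [z _|v z _]; first exact: bd.
have E y : 'D_v (bump rho) y =
    2 * Num.max 0 (rho ^+ 2 - sqnorm y) * - (\sum_i 2 * y 0 i * v 0 i).
  have H1 : is_derive y v (fun z => rho ^+ 2 - sqnorm z)
      (0 - \sum_i 2 * y 0 i * v 0 i).
    exact: (is_deriveB (is_derive_cst _ _ _) (is_derive_sqnorm y v)).
  have H2 := is_derive_max0_sqr (rho ^+ 2 - sqnorm y).
  have d2 : differentiable (fun s : R => Num.max 0 s ^+ 2) (rho ^+ 2 - sqnorm y).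
    by apply/derivable1_diffP; exact: ex_derive.
  have H := is_derive_comp_diff (F := fun z => rho ^+ 2 - sqnorm z) d2 H1.
  rewrite (@derive_val _ _ _ _ _ _ _ H) sub0r.
  rewrite deriv1E; last exact: ex_derive.
  by rewrite derive1E (@derive_val _ _ _ _ _ _ _ H2); exact: mulrC.
rewrite /= (_ : 'D_v (bump rho) = fun y => 2 * Num.max 0 (rho ^+ 2 - sqnorm y) *
  - (\sum_i 2 * y 0 i * v 0 i)); last by apply/funext.
have cy i : {for z, continuous (fun y : rV => y 0 i)} by exact: coord_continuous.
have cm : {for z, continuous (fun y : rV => Num.max 0 (rho ^+ 2 - sqnorm y))}.
  apply: (@continuous_max R rV (cst 0) (fun y => rho ^+ 2 - sqnorm y)).
    exact: cst_continuous.
  by apply: differentiable_continuous; exact: rd.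
have cs : {for z, continuous (fun y : rV => \sum_i 2 * y 0 i * v 0 i)}.
  apply: (@cvg_sum_seq R _ (nbhs z)) => i.
  exact: (cvgM (cvgM (cvg_cst _) (cy i)) (cvg_cst _)).
exact: (cvgM (cvgM (cvg_cst _) cm) (cvgN cs)).
Qed.

Lemma bump_eq0 rho z : 0 <= rho -> rho < `|z| -> bump rho z = 0.
Proof.
move=> rho0 rz; rewrite /bump max_l ?expr0n//.
have [] := leP (rho ^+ 2) (sqnorm z); first by rewrite subr_le0.
move=> qz; have : `|z| <= rho.
  apply: norm_mx_le => // i j; rewrite (ord1 i).
  rewrite -(ler_pXn2r (n := 2))// ?nnegrE//.
  rewrite (le_trans _ (ltW qz))// /sqnorm (bigD1 j)//= real_normK ?num_real//.
  by rewrite lerDl sumr_ge0// => l _; exact: sqr_ge0.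
by rewrite leNgt rz.
Qed.

Lemma exists_bump rho : 0 < rho -> exists phi : rV -> R,
  [/\ class_C 1 setT phi, forall z, rho < `|z| -> phi z = 0 & iintegral phi = 1].
Proof.
move=> rho0; have rho0' := ltW rho0.
have [bd b2] := bump_C1 rho.
have bcc : Cc_ball rho (bump rho).
  split; last by move=> z; exact: bump_eq0.
  by move=> z; apply: differentiable_continuous; exact: bd.
have I0 : 0 < iintegral (bump rho).
  apply: (@iintegral_gt0 R n rho (bump rho) 0 rho0' bcc).
    by move=> z; exact: sqr_ge0.
  rewrite /bump /sqnorm big1 ?subr0; last by move=> i _; rewrite mxE expr0n.
  by rewrite max_r ?exprn_gt0// ltW ?exprn_gt0.
pose c := (iintegral (bump rho))^-1.
exists (fun z => c * bump rho z); split.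
- have E v z : 'D_v (fun z => c * bump rho z) z = c * 'D_v (bump rho) z.
    by apply: deriveZ; apply: diff_derivable; exact: bd.
  split => [z _|v z _]; first by apply: differentiableZ; exact: bd.
  rewrite /= (_ : 'D_v _ = fun z => c * 'D_v (bump rho) z); last exact/funext/E.
  have b2z : {for z, continuous ('D_v (bump rho))} := b2 v z Logic.I.
  exact: (cvgM (cvg_cst c) b2z).
- by move=> z rz; rewrite bump_eq0// mulr0.
- by rewrite (iintegralZ _ rho0' bcc) mulVf// gt_eqF.
Qed.

End Bump.

(** * Closure properties of class C^k, applied to the map in coordinates *)

Section SmoothFunctions.
Variables (R : realType) (n : nat).
Local Notation rV := 'rV[R]_n.
Implicit Types (f h : rV -> R).

Lemma class_C_subset (W : normedModType R) k (A B : set rV) (f : rV -> W) :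
  B `<=` A -> class_C k A f -> class_C k B f.
Proof.
move=> BA; elim: k f => [|k IH] f /=; first by move=> fc x /BA /fc.
by move=> [fd fC]; split=> [x /BA /fd//|v]; exact/IH/fC.
Qed.

Lemma class_C_pred (W : normedModType R) k (A : set rV) (f : rV -> W) :
  class_C k.+1 A f -> class_C k A f.
Proof.
elim: k f => [|k IH] f [fd fC].
  by move=> x Ax; exact/differentiable_continuous/fd.
by split => // v; exact/IH/fC.
Qed.

Lemma class_C_cst (W : normedModType R) k (c : W) : class_C k setT (fun _ : rV => c).
Proof.
elim: k c => [|k IH] c; first by move=> x _; exact: cst_continuous.
split=> [x _|v]; first exact: differentiable_cst.
rewrite (_ : 'D_v _ = fun=> 0); first exact: IH.
by apply/funext => x; rewrite derive_cst.
Qed.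

Lemma class_C_coord k i : class_C k setT (fun z : rV => z 0 i).
Proof.
case: k => [|k]; first by move=> x _; exact: coord_continuous.
split=> [x _|v]; first exact: differentiable_coord.
rewrite (_ : 'D_v _ = fun=> v 0 i); first exact: class_C_cst.
apply/funext => x; have := is_derive_coord 0 i (is_derive_id x v).
by move=> [].
Qed.

Lemma class_CD (W : normedModType R) k (f h : rV -> W) :
  class_C k setT f -> class_C k setT h -> class_C k setT (fun z => f z + h z).
Proof.
elim: k f h => [|k IH] f h.
  by move=> fc hc x _; exact: (cvgD (fc x Logic.I) (hc x Logic.I)).
move=> [fd fC] [hd hC]; split=> [x _|v].
  by apply: differentiableD; [exact: fd|exact: hd].
rewrite (_ : 'D_v _ = fun z => 'D_v f z + 'D_v h z).
  by apply: IH; [exact: fC|exact: hC].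
by apply/funext => x; apply: deriveD; apply: diff_derivable; [exact: fd|exact: hd].
Qed.

Lemma class_CM k f h :
  class_C k setT f -> class_C k setT h -> class_C k setT (fun z => f z * h z).
Proof.
elim: k f h => [|k IH] f h.
  by move=> fc hc x _; exact: (cvgM (fc x Logic.I) (hc x Logic.I)).
move=> fC' hC'; have fCk := class_C_pred fC'; have hCk := class_C_pred hC'.
case: fC' hC' => [fd fC] [hd hC]; split=> [x _|v].
  by apply: differentiableM; [exact: fd|exact: hd].
rewrite (_ : 'D_v _ = fun z => f z * 'D_v h z + h z * 'D_v f z).
  by apply: class_CD; apply: IH => //; [exact: hC|exact: fC].
by apply/funext => x; apply: deriveM; apply: diff_derivable; [exact: fd|exact: hd].
Qed.

Lemma class_C_sum (W : normedModType R) (I : Type) (s : seq I) (P : pred I) k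
    (f : I -> rV -> W) : (forall i, class_C k setT (f i)) ->
  class_C k setT (fun z => \sum_(i <- s | P i) f i z).
Proof.
move=> fC; elim: s => [|i s IH].
  rewrite (_ : (fun z => _) = fun=> 0); first exact: class_C_cst.
  by apply/funext => z; rewrite big_nil.
rewrite (_ : (fun z => _) = fun z =>
  (if P i then f i z else 0) + \sum_(j <- s | P j) f j z).
  by apply: class_CD => //; case: (P i) => //; exact: class_C_cst.
by apply/funext => z; rewrite big_cons; case: ifP => // _; rewrite add0r.
Qed.

Lemma class_C_expR k f : class_C k setT f -> class_C k setT (fun z => expR (f z)).
Proof.
elim: k f => [|k IH] f.
  by move=> fc x _; exact: (cvg_comp _ _ (fc x Logic.I) (@continuous_expR R (f x))).
move=> fC'; have fCk := class_C_pred fC'; case: fC' => fd fC.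
have ed x : differentiable (@expR R) x.
  by apply/derivable1_diffP; exact: derivable_expR.
split=> [x _|v].
  by apply: (@differentiable_comp R rV R R f (@expR R)); [exact: fd|exact: ed].
rewrite (_ : 'D_v _ = fun z => expR (f z) * 'D_v f z).
  by apply: class_CM; [exact: IH|exact: fC].
apply/funext => x.
have Hf : is_derive x v f ('D_v f x) by apply/derivableP/diff_derivable/fd.
have H := is_derive_comp_diff (ed (f x)) Hf.
rewrite (@derive_val _ _ _ _ _ _ _ H) deriv1E; last exact: derivable_expR.
by rewrite derive1E (@derive_val _ _ _ _ _ _ _ (is_derive_expR (f x))); exact: mulrC.
Qed.

Lemma class_C_scalel (W : normedModType R) k f (c : W) :
  class_C k setT f -> class_C k setT (fun z => f z *: c).
Proof.
elim: k f => [|k IH] f.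
  move=> fc x _; exact: (cvgZ (fc x Logic.I) (cvg_cst c)).
move=> [fd fC]; split=> [x _|v].
  by apply: differentiableZl; exact: fd.
rewrite (_ : 'D_v _ = fun z => 'D_v f z *: c); first exact/IH/fC.
apply/funext => x; rewrite deriveE; last by apply: differentiableZl; exact: fd.
by rewrite diffZl ?deriveE//; exact: fd.
Qed.

Lemma class_C_row m k (f : rV -> 'rV[R]_m) :
  (forall j, class_C k setT (fun z => f z 0 j)) -> class_C k setT f.
Proof.
move=> fC; rewrite (_ : f = fun z => \sum_j f z 0 j *: delta_mx 0 j).
  by apply: class_C_sum => j; exact: class_C_scalel.
by apply/funext => z; rewrite -row_sum_delta.
Qed.

End SmoothFunctions.

Section CoordinateMap.
Variables (R : realType) (V : finType) (e : rel V) (w : V -> V -> R) (mu : V -> R).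
Variables (lambda eta : R).
Local Notation N := (#|V| + #|V|)%N.

Definition calFc (f g : V -> R) : 'rV[R]_N -> 'rV[R]_N :=
  @to_coord R V \o calF e w mu lambda eta f g \o @of_coord R V.

Lemma class_C_calFc k f g : class_C k setT (calFc f g).
Proof.
have u_C x : class_C k setT (fun z : 'rV[R]_N => (of_coord z).1 x).
  rewrite (_ : (fun z => _) = fun z : 'rV[R]_N => z 0 (lshift _ (enum_rank x))).
    exact: class_C_coord.
  by apply/funext => z; rewrite /of_coord /= mxE.
have v_C x : class_C k setT (fun z : 'rV[R]_N => (of_coord z).2 x).
  rewrite (_ : (fun z => _) = fun z : 'rV[R]_N => z 0 (rshift _ (enum_rank x))).
    exact: class_C_coord.
  by apply/funext => z; rewrite /of_coord /= mxE.
have opp_C (h : 'rV[R]_N -> R) : class_C k setT h -> class_C k setT (fun z => - h z).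
  move=> hC; rewrite (_ : (fun z => _) = fun z => (-1) * h z).
    by apply: class_CM => //; exact: class_C_cst.
  by apply/funext => z; rewrite mulN1r.
have lap_C (h : 'rV[R]_N -> V -> R) x : (forall y, class_C k setT (h ^~ y)) ->
    class_C k setT (fun z => - laplacian e w mu (h z) x).
  move=> hC; apply: (opp_C); apply: class_CM; first exact: class_C_cst.
  apply: class_C_sum => y; apply: class_CM; first exact: class_C_cst.
  by apply: class_CD => //; exact: opp_C.
have nl_C (h1 h2 : 'rV[R]_N -> R) c : class_C k setT h1 -> class_C k setT h2 ->
    class_C k setT (fun z => c * expR (h1 z) * (expR (h2 z) - 1)).
  move=> C1 C2; apply: class_CM.
    by apply: class_CM; [exact: class_C_cst|exact: class_C_expR].
  by apply: class_CD; [exact: class_C_expR|exact: class_C_cst].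
apply: class_C_row => j; rewrite /calFc /to_coord /=.
case: (split_ordP j) => i ->.
  rewrite (_ : (fun z => _) = fun z =>
    (calF e w mu lambda eta f g (of_coord z)).1 (enum_val i)); last first.
    by apply/funext => z; rewrite row_mxEl mxE.
  apply: class_CD; last exact: class_C_cst.
  apply: class_CD; last by apply: (nl_C); [exact: v_C|exact: u_C].
  by apply: (lap_C (fun z => (of_coord z).1)) => y; exact: u_C.
rewrite (_ : (fun z => _) = fun z =>
  (calF e w mu lambda eta f g (of_coord z)).2 (enum_val i)); last first.
  by apply/funext => z; rewrite row_mxEr mxE.
apply: class_CD; last exact: class_C_cst.
apply: class_CD; last by apply: (nl_C); [exact: u_C|exact: v_C].
by apply: (lap_C (fun z => (of_coord z).2)) => y; exact: v_C.
Qed.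

End CoordinateMap.

(** * A priori bounds on the graph *)

Section APriori.
Variables (R : realType) (V : finType) (e : rel V) (w : V -> V -> R) (mu : V -> R).
Hypotheses (e_sym : symmetric e) (e_conn : connected_graph e).
Hypotheses (w_pos : forall x y, e x y -> 0 < w x y)
  (w_sym : forall x y, e x y -> w x y = w y x) (mu_pos : forall x, 0 < mu x).
Local Notation Lap := (laplacian e w mu).
Implicit Types (u v : V -> R).

(** The measure cancels, and what remains is a double sum over edges that is antisymmetric by the
    symmetry of [e] and [w]. *)
Lemma integral_laplacian u : integral_V mu (Lap u) = 0.
Proof.
pose B x y := if e x y then w x y * (u y - u x) else 0.
have -> : integral_V mu (Lap u) = \sum_x \sum_y B x y.
  apply: eq_bigr => x _; rewrite /laplacian mulrA divff ?mul1r ?gt_eqF//.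
  by rewrite big_mkcond.
set S := LHS; have : S *+ 2 == 0; last by rewrite mulrn_eq0 => /eqP.
rewrite mulr2n {1}/S exchange_big /S -big_split big1//= => x _.
rewrite -big_split big1//= => y _; rewrite /B (e_sym y x).
case: ifP => [exy|_]; last by rewrite addr0.
by rewrite (w_sym exy); ring.
Qed.

(** The other neighbours raise the Laplacian at [x] by a bounded amount, as they exceed [u x] by at
    most [C]. A lower value at [y] would therefore push it below [- K]. *)
Lemma laplacian_neighbor u x y K C : e x y -> - K <= Lap u x -> 0 <= C ->
  (forall z, u z <= u x + C) ->
  u x - (K * mu x + C * \sum_(z | e x z) w x z) / w x y <= u y.
Proof.
move=> exy + C0 uC; rewrite /laplacian => H.
have wy := w_pos exy.
have H2 : - (K * mu x) <= \sum_(z | e x z) w x z * (u z - u x).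
  by rewrite -mulNr -ler_pdivlMr// mulrC.
have H3 : \sum_(z | e x z) w x z * (u z - u x) <=
    w x y * (u y - u x) + C * \sum_(z | e x z) w x z.
  rewrite (bigD1 y)//= lerD2l mulr_sumr [leRHS](bigD1 y)//= ler_wpDl//.
    by rewrite mulr_ge0// ltW.
  apply: ler_sum => z /andP[exz _]; rewrite mulrC.
  by apply: ler_wpM2r; [rewrite ltW// w_pos|have := uC z; lra].
rewrite lerBlDr -lerBlDl ler_pdivlMr//.
have := le_trans H2 H3; lra.
Qed.

(* At a point where [u] is within [C] of its maximum and [u >= 0], the lower bound
   on the Laplacian forces [u] to be within a controlled constant of its maximum
   at all neighbours.  If the maximum were too large, this would propagate along
   paths and [u] would be nonnegative everywhere. *)
Lemma subharmonic_bound K : 0 <= K -> exists2 C, 0 <= C &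
  forall u, (forall x, 0 <= u x -> - K <= Lap u x) -> (exists z, u z < 0) ->
  forall x, u x <= C.
Proof.
move=> K0.
pose W x := \sum_(z | e x z) w x z.
have W0 x : 0 <= W x by apply: sumr_ge0 => z /w_pos/ltW.
(* A single constant for all edges: the sum of nonnegative ratios dominates each of them. *)
pose B := \sum_(p : V * V | e p.1 p.2) (mu p.1 + W p.1) / w p.1 p.2.
have Bt (p : V * V) : e p.1 p.2 -> 0 <= (mu p.1 + W p.1) / w p.1 p.2.
  by move=> /w_pos wp; rewrite divr_ge0 ?addr_ge0// ltW.
have B0 : 0 <= B by apply: sumr_ge0.
have BP x y : e x y -> (mu x + W x) / w x y <= B.
  by move=> exy; rewrite /B (bigD1 (x, y))//= lerDl sumr_ge0// => p /andP[/Bt].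
(* [c k] bounds the loss after [k] steps away from the maximum. *)
pose c := fix c k := if k is k'.+1 then c k' + B * (K + c k') else 0.
have c0 k : 0 <= c k.
  by elim: k => //= k IH; rewrite addr_ge0// mulr_ge0// addr_ge0.
have cS k : c k <= c k.+1 by rewrite /= lerDl mulr_ge0// addr_ge0.
have cle i j : (i <= j)%N -> c i <= c j.
  by move=> /subnK <-; elim: (j - i)%N => //= m IH; exact: le_trans IH (cS _).
exists (c #|V|) => // u uK [z uz] x.
have [m _ mP] := @arg_maxP _ _ _ z predT u isT.
apply: le_trans (mP x isT) _; rewrite leNgt; apply/negP => cM.
have key p : forall y i, path e y p -> (i + size p <= #|V|)%N ->
    u m - c i <= u y -> u m - c (i + size p)%N <= u (last y p).
  elim: p => [|y' p IH] y i /=; first by rewrite addn0.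
  move=> /andP[eyy' pp]; rewrite addnS -addSn => ip uy.
  apply: IH => //=.
  have ci : c i <= c #|V| by apply: cle; apply: leq_trans ip; rewrite addSn leqW// leq_addr.
  have uy0 : 0 <= u y by lra.
  have uC z' : u z' <= u y + c i by have := mP z' isT; rewrite /= => h; lra.
  have := laplacian_neighbor eyy' (uK y uy0) (c0 i) uC; rewrite -/(W y) => h.
  have wp := w_pos eyy'.
  have : (K * mu y + c i * W y) / w y y' <= B * (K + c i).
    apply: (@le_trans _ _ ((mu y + W y) / w y y' * (K + c i))).
      rewrite mulrAC ler_pM2r ?invr_gt0//.
      have := mulr_ge0 (c0 i) (ltW (mu_pos y)); have := mulr_ge0 K0 (W0 y).
      lra.
    by rewrite ler_wpM2r ?BP// addr_ge0.
  lra.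
have /connectP[p pp zE] := e_conn m z.
(* A path without repeated vertices has fewer than [#|V|] steps, so the loss at [z] is at most
   [c #|V|], against [u z < 0]. *)
case/shortenP: pp zE => q pq uq _ zE.
have sq : (size q < #|V|)%N.
  by have := card_uniqP uq => /= <-; exact: max_card.
have := key q m 0%N pq (ltnW sq).
rewrite /= subr0 => /(_ (lexx _)); rewrite add0n -zE.
have := cle _ _ (ltnW sq); lra.
Qed.

Variables (lambda eta : R).
Hypotheses (lambda_pos : 0 < lambda) (eta_pos : 0 < eta).

Lemma laplacian_max u m : (forall x, u x <= u m) -> Lap u m <= 0.
Proof.
move=> um; rewrite /laplacian pmulr_rle0 ?invr_gt0//.
by apply: sumr_le0 => y emy; rewrite pmulr_rle0 ?w_pos// subr_le0.
Qed.

(* A zero of the map is a pair with [half_zero lambda f u v] and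
   [half_zero eta g v u]. *)
Definition half_zero (c : R) (f u v : V -> R) :=
  forall x, - Lap u x + c * expR (v x) * (expR (u x) - 1) + f x = 0.

Lemma half_zero_lap c f u v x : half_zero c f u v ->
  Lap u x = c * expR (v x) * (expR (u x) - 1) + f x.
Proof. by move=> /(_ x); lra. Qed.

Lemma half_zero_integral c f u v : half_zero c f u v ->
  integral_V mu (fun x => c * expR (v x) * (expR (u x) - 1)) = - integral_V mu f.
Proof.
move=> H; apply/eqP; rewrite -subr_eq0 opprK /integral_V -big_split /=.
apply/eqP; rewrite -[RHS](integral_laplacian u); apply: eq_bigr => x _.
by rewrite (half_zero_lap x H); ring.
Qed.

(** With [u >= 0] everywhere the nonlinear term would have a nonnegative integral, whereas it equals
    minus that of [f]. *)
Lemma half_zero_exists_neg c f u v : 0 < c -> half_zero c f u v ->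
  0 < integral_V mu f -> exists z, u z < 0.
Proof.
move=> c0 H f0; apply: contrapT => /forallNP nu.
have := half_zero_integral H.
have : 0 <= integral_V mu (fun x => c * expR (v x) * (expR (u x) - 1)).
  apply: sumr_ge0 => x _; apply: mulr_ge0; first exact: ltW.
  apply: mulr_ge0; first by rewrite mulr_ge0 ?expR_ge0// ltW.
  rewrite subr_ge0 -expR0 ler_expR leNgt; apply/negP; exact: nu.
lra.
Qed.

(** Where [u >= 0] the nonlinear term is nonnegative whatever [v] is, so the Laplacian is at least
    [- K] there without a bound on [v]. This is why [subharmonic_bound] looks only at such
    points. *)
Lemma half_zero_upper c K : 0 < c -> 0 <= K -> exists2 C, 0 <= C &
  forall f u v, (forall x, `|f x| <= K) -> 0 < integral_V mu f ->
    half_zero c f u v -> forall x, u x <= C.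
Proof.
move=> c0 K0; have [C C0 CP] := subharmonic_bound K0.
exists C => // f u v fK f0 H; apply: CP; last exact: half_zero_exists_neg H f0.
move=> x ux; rewrite (half_zero_lap x H).
have : 0 <= c * expR (v x) * (expR (u x) - 1).
  apply: mulr_ge0; first by rewrite mulr_ge0 ?expR_ge0// ltW.
  by rewrite subr_ge0 -expR0 ler_expR.
by have := fK x; rewrite ler_norml => /andP[]; lra.
Qed.

(** Upper bounds on both unknowns bound the Laplacian of [u] from above, so [subharmonic_bound]
    applies to a translate of [- u]. *)
Lemma half_zero_lower c K C D : 0 < c -> 0 <= K -> exists2 C', 0 <= C' &
  forall f u v, (forall x, `|f x| <= K) -> half_zero c f u v ->
    (forall x, u x <= C) -> (forall x, v x <= C) -> (exists z, D <= u z) ->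
    forall x, - C' <= u x.
Proof.
move=> c0 K0.
(* The sign in [expR C + 1] keeps this factor nonnegative for every [C]. *)
pose K' := c * expR C * (expR C + 1) + K.
have K'0 : 0 <= K'.
  by rewrite addr_ge0// !mulr_ge0 ?addr_ge0 ?expR_ge0// ltW.
have [E E0 EP] := subharmonic_bound K'0.
exists (E + `|D| + 1); first by rewrite !addr_ge0.
move=> f u v fK H uC vC [z Dz] x.
(* The translation makes [u' z <= - 1], the negative value that [subharmonic_bound] requires. *)
pose u' y := - u y + D - 1.
have : u' x <= E.
  apply: EP; last by exists z; rewrite /u'; lra.
  move=> y _.
  have -> : Lap u' y = - Lap u y.
    rewrite /laplacian -mulrN -sumrN; congr (_ * _); apply: eq_bigr => t _.
    by rewrite /u'; ring.
  rewrite lerN2 (half_zero_lap y H) /K' lerD//; last first.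
    by have := fK y; rewrite ler_norml => /andP[].
  apply: (@le_trans _ _ (c * expR (v y) * (expR C + 1))).
    rewrite ler_wpM2l ?mulr_ge0 ?expR_ge0 ?ltW//.
    have : expR (u y) <= expR C by rewrite ler_expR; exact: uC.
    lra.
  rewrite ler_wpM2r ?addr_ge0 ?expR_ge0// ler_wpM2l ?(ltW c0)// ler_expR//.
by rewrite /u'; have := ler_norm (- D); rewrite normrN; lra.
Qed.

(** If [c * expR (v z) < d] everywhere, the nonlinear term exceeds [- d] at each vertex, and its
    integral, minus that of [f], is too large. The equation of [u] thus gives information on [v]. *)
Lemma half_zero_not_small c f u v d : 0 < c -> 0 < d -> half_zero c f u v ->
  d * integral_V mu (fun=> 1) <= integral_V mu f -> 0 < integral_V mu f ->
  exists z, ln (d / c) <= v z.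
Proof.
move=> c0 d0 H df f0; apply: contrapT => /forallNP nu.
have vlt z : c * expR (v z) < d.
  have : v z < ln (d / c) by rewrite ltNge; apply/negP; exact: nu.
  by rewrite -ltr_expR lnK ?posrE ?divr_gt0// ltr_pdivlMr// mulrC.
have := half_zero_integral H; apply/eqP; rewrite gt_eqF//.
(* A vertex, needed for the comparison of sums to be strict. *)
have [z0 _] := half_zero_exists_neg c0 H f0.
apply: (@le_lt_trans _ _ (- (d * integral_V mu (fun=> 1)))); first by rewrite lerN2.
rewrite /integral_V mulr_sumr -sumrN.
apply: ltr_sum; first by apply/hasP; exists z0 => //; rewrite mem_index_enum.
move=> x _; rewrite mulr1 mulrC -mulrN ltr_pM2l//.
have := vlt x; have := expR_gt0 (u x); have := expR_gt0 (v x) => h1 h2 h3.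
have := mulr_gt0 (mulr_gt0 c0 h1) h2; lra.
Qed.

(** The order matters: both upper bounds come first, each from its own equation. The lower bound of
    [u] then uses both of them and the point given by the equation of [v], whence [ln (d / eta)];
    likewise for [v] with [ln (d / lambda)]. *)
Lemma zero_bound K d : 0 <= K -> 0 < d -> exists2 C, 0 <= C &
  forall f g u v, (forall x, `|f x| <= K) -> (forall x, `|g x| <= K) ->
    0 < integral_V mu f -> 0 < integral_V mu g ->
    d * integral_V mu (fun=> 1) <= integral_V mu f ->
    d * integral_V mu (fun=> 1) <= integral_V mu g ->
    half_zero lambda f u v -> half_zero eta g v u ->
    forall x, `|u x| <= C /\ `|v x| <= C.
Proof.
move=> K0 d0.
have [C1 C10 C1P] := half_zero_upper lambda_pos K0.
have [C2 C20 C2P] := half_zero_upper eta_pos K0.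
pose C := C1 + C2.
have [E1 E10 E1P] := half_zero_lower C (ln (d / eta)) lambda_pos K0.
have [E2 E20 E2P] := half_zero_lower C (ln (d / lambda)) eta_pos K0.
exists (C + E1 + E2); first by rewrite !addr_ge0.
move=> f g u v fK gK f0 g0 df dg Hu Hv x.
have uC y : u y <= C by apply: (le_trans (C1P _ _ _ fK f0 Hu y)); rewrite lerDl.
have vC y : v y <= C by apply: (le_trans (C2P _ _ _ gK g0 Hv y)); rewrite lerDr.
have uE := E1P _ _ _ fK Hu uC vC (half_zero_not_small eta_pos d0 Hv dg g0) x.
have vE := E2P _ _ _ gK Hv vC uC (half_zero_not_small lambda_pos d0 Hu df f0) x.
by have := uC x; have := vC x; rewrite !ler_norml; split; apply/andP; split; lra.
Qed.

Lemma half_zero_cst_neg c u v : (0 < c) -> half_zero c (fun=> c) u v ->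
  forall x, u x < 0.
Proof.
move=> c0 H x.
have [m _ mP] := @arg_maxP _ _ _ x predT u isT.
apply: le_lt_trans (mP x isT) _.
have := laplacian_max (fun y => mP y isT); rewrite (half_zero_lap m H) => h.
rewrite ltNge; apply/negP => um.
have : 0 <= c * expR (v m) * (expR (u m) - 1).
  apply: mulr_ge0; first by rewrite mulr_ge0 ?expR_ge0// ltW.
  by rewrite subr_ge0 -expR0 ler_expR.
lra.
Qed.

Lemma no_zero_cst u v (x0 : V) : half_zero lambda (fun=> lambda) u v ->
  half_zero eta (fun=> eta) v u -> False.
Proof.
move=> Hu Hv; have v0 := half_zero_cst_neg eta_pos Hv.
have [m _ mP] := @arg_maxP _ _ _ x0 predT u isT.
have := laplacian_max (fun y => mP y isT); rewrite (half_zero_lap m Hu).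
have : expR (v m) < 1 by rewrite -expR0 ltr_expR.
have := expR_gt0 (u m); have := expR_gt0 (v m) => h1 h2 h3.
have := mulr_gt0 lambda_pos (mulr_gt0 h1 h2).
have : 0 < lambda * (1 - expR (v m)) by rewrite mulr_gt0// subr_gt0.
lra.
Qed.

End APriori.

(** * Vanishing of the degree *)

Section VanishingDegree.
Variables (R : realType) (n : nat).
Local Notation rV := 'rV[R]_n.

Lemma class_CZ (W : normedModType R) k a (f : rV -> W) :
  class_C k setT f -> class_C k setT (fun z => a *: f z).
Proof.
elim: k f => [|k IH] f.
  move=> fc x _; exact: (cvgZ (cvg_cst a) (fc x Logic.I)).
move=> [fd fC]; split=> [x _|v].
  by apply: differentiableZ; exact: fd.
rewrite (_ : 'D_v _ = fun z => a *: 'D_v f z); first exact/IH/fC.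
by apply/funext => x; apply: deriveZ; apply: diff_derivable; exact: fd.
Qed.

Lemma bounded_closure (A : set rV) : bounded_set A -> bounded_set (closure A).
Proof.
move=> [M [Mr AM]]; exists M; split => // x Mx y cAy.
rewrite /= leNgt; apply/negP => xy.
have N : nbhs y [set z : rV | x < `|z|].
  apply: (@cvgr_gt R _ (nbhs y) _ (fun z : rV => `|z|) `|y|) => //.
  exact: norm_continuous.
by have [z [Az /=]] := cAy _ N; rewrite ltNge (AM x Mx z Az).
Qed.

Lemma brouwer_degree_eq0 (A : set rV) (Phi : rV -> rV) (h : rV) :
  open A -> bounded_set A -> class_C 2 setT Phi ->
  (forall t x, 0 <= t <= 1 -> closure A x -> ~ A x -> Phi x + t *: h <> 0) ->
  (forall x, closure A x -> Phi x + h <> 0) ->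
  is_brouwer_degree A Phi 0 0.
Proof.
move=> oA bA PC bdh nz.
have Pc : continuous Phi by move=> x; apply: differentiable_continuous; exact: PC.1.
have Pcl : {within closure A, continuous Phi} by exact: continuous_subspaceT.
have ccA : compact (closure A).
  by apply: bounded_closed_compact; [exact: bounded_closure|exact: closed_closure].
have cdA : compact (closure A `\` A).
  by rewrite setDE; apply: compact_closedI => //; exact: open_closedC.
have c01 : compact (`[(0:R), 1]%classic : set R) by exact: segment_compact.
have PA k : class_C k setT Phi -> class_C k A Phi by exact: class_C_subset.
have segc : continuous (fun p : R * rV => `|Phi p.2 + p.1 *: h|).
  move=> p; apply: cvg_norm; apply: cvgD.
    exact: (snd_cts (Pc p.2)).
  by apply: cvgZ; [exact: cvg_fst|exact: cvg_cst].
have [m1 m10 m1P] : exists2 m, 0 < m & forall p : R * rV,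
    (`[(0:R), 1]%classic `*` (closure A `\` A)) p -> m <= `|Phi p.2 + p.1 *: h|.
  apply: (compact_pos_lbound (compact_setX c01 cdA)).
    exact: continuous_subspaceT.
  move=> [t x] /= [t01 [cAx nAx]]; rewrite normr_gt0; apply/eqP.
  by apply: bdh => //; move: t01; rewrite in_itv.
have [m2 m20 m2P] : exists2 m, 0 < m & forall x : rV, closure A x -> m <= `|Phi x + h|.
  apply: (compact_pos_lbound ccA).
    apply: continuous_subspaceT => x.
    exact: (cvg_norm (cvgD (Pc x) (cvg_cst h))).
  by move=> x cAx; rewrite normr_gt0; apply/eqP; exact: nz.
have P0 x : (closure A `\` A) x -> m1 <= `|Phi x|.
  move=> xA; have := m1P (0, x); rewrite /= scale0r addr0; apply.
  by split => //=; rewrite in_itv/= lexx ler01.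
split => //.
- by move=> x xA Px; have := P0 x xA; rewrite Px normr0 leNgt m10.
(* The radius [m1 / 4] makes [2 * r < m1], and [Phi], being smooth, approximates itself. *)
- have [phi [phiC phi0 phi1]] := exists_bump n (divr_gt0 m10 (ltr0n R 4)).
  exists (m1 / 4), Phi, phi; split => //.
  + by rewrite divr_gt0.
  + by move=> x xA; rewrite subr0; apply: lt_le_trans (P0 x xA); lra.
  + by split => //; exact: PA.
  + by move=> x _; rewrite subrr normr0 ltW// divr_gt0.
  + by split => // z; rewrite subr0; exact: phi0.
- move=> r g phi [r0 rbd [gc gC] gP [phiC phi0 _]].
  have phi0' z : r < `|z| -> phi z = 0 by move=> rz; apply: phi0; rewrite subr0.
  (* [S * m1] and [S * m2] exceed [r], for the boundary values of [S *: (Phi + t *: h)] and for all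
     values of [S *: (Phi + h)]; [1 <= S] serves the first deformation, starting at [g]. *)
  pose S := 1 + r / m1 + r / m2.
  have S1 : 1 <= S.
    by rewrite /S; have := divr_gt0 r0 m10; have := divr_gt0 r0 m20; lra.
  have S0 : 0 < S by lra.
  have Sm1 : r < S * m1.
    have : r / m1 * m1 = r by rewrite divfK ?gt_eqF.
    by have := mulr_gt0 (divr_gt0 r0 m20) m10; rewrite /S; lra.
  have Sm2 : r < S * m2.
    have : r / m2 * m2 = r by rewrite divfK ?gt_eqF.
    by have := mulr_gt0 (divr_gt0 r0 m10) m20; rewrite /S; lra.
  have C1 : class_C 2 setT (fun z => S *: Phi z) by exact: class_CZ.
  have C2 : class_C 2 setT (fun z => S *: (Phi z + h)).
    exact: (class_CZ S (class_CD PC (@class_C_cst R n rV 2 h))).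
  have toA (f : rV -> rV) : class_C 2 setT f -> class_C 2 A f by exact: class_C_subset.
  have towc (f : rV -> rV) : class_C 2 setT f -> {within closure A, continuous f}.
    move=> fC; apply: continuous_subspaceT => x.
    by apply: differentiable_continuous; exact: fC.1.
  rewrite -[LHS]/(degree_integral A phi g).
  rewrite (degree_integral_homotopy oA bA phiC phi0' gC (toA _ C1) gc (towc _ C1)).
    rewrite (degree_integral_homotopy oA bA phiC phi0' (toA _ C1) (toA _ C2)
      (towc _ C1) (towc _ C2)).
      apply: (degree_integral_eq0 phi0') => x Ax.
      rewrite normrZ gtr0_norm//; apply: lt_le_trans Sm2 _.
      by rewrite ler_pM2l//; apply: m2P; exact: subset_closure.
    move=> s x s01 cAx nAx.
    rewrite -scalerBr addrAC subrr add0r scalerA mulrC -scalerA -scalerDr.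
    rewrite normrZ gtr0_norm//; apply: lt_le_trans Sm1 _.
    by rewrite ler_pM2l//; apply: (m1P (s, x)); split => //=; rewrite in_itv.
  move=> s x /andP[s0 s1] cAx nAx.
  have P2 := rbd x (conj cAx nAx); rewrite subr0 in P2.
  (* The coefficient of [Phi x] is at least 1 and [Phi x] has norm above [2 * r], while the error
     term has norm at most [r]: the norm of the sum exceeds [r]. *)
  have -> : g x + s *: (S *: Phi x - g x) =
      ((1 - s) + s * S) *: Phi x + (1 - s) *: (g x - Phi x).
    apply/rowP => j; rewrite !mxE; ring.
  have gPx := gP x cAx.
  have : `|((1 - s) + s * S) *: Phi x| - `|(1 - s) *: (g x - Phi x)| <=
      `|((1 - s) + s * S) *: Phi x + (1 - s) *: (g x - Phi x)|.
    by rewrite lerBlDr -{1}(addrK ((1 - s) *: (g x - Phi x)) (_ *: Phi x)) ler_normB.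
  apply: lt_le_trans; rewrite !normrZ.
  have sS : 1 <= 1 - s + s * S by have := ler_wpM2l s0 S1; lra.
  rewrite (ger0_norm (le_trans ler01 sS)) (ger0_norm (_ : 0 <= 1 - s)) ?subr_ge0//.
  have := ler_wpM2r (normr_ge0 (Phi x)) sS.
  have : (1 - s) * `|g x - Phi x| <= 1 * r.
    by apply: ler_pM => //; rewrite ?subr_ge0//; lra.
  lra.
Qed.

End VanishingDegree.

(** * The ball in coordinates, and the conclusion *)

Section Coordinates.
Variables (R : realType) (V : finType).
Local Notation N := (#|V| + #|V|)%N.

Lemma norm_oo_ge (u : V -> R) x : `|u x| <= norm_oo u.
Proof. by rewrite /norm_oo; exact: le_bigmax_cond. Qed.

Lemma norm_oo_le (u : V -> R) c : 0 <= c -> (forall x, `|u x| <= c) -> norm_oo u <= c.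
Proof. by move=> c0 uc; apply: bigmax_le. Qed.

Lemma norm_oo_continuous (T : topologicalType) (u : T -> V -> R) :
  (forall x, continuous (u ^~ x)) -> continuous (fun t => norm_oo (u t)).
Proof.
move=> uc t; rewrite /norm_oo.
elim: (index_enum V) => [|x s IH].
  under eq_fun do rewrite big_nil; exact: cst_continuous.
under eq_fun do rewrite big_cons /=.
apply: (@continuous_max R T (fun t => `|u t x|)) => //.
exact: (cvg_norm (uc x t)).
Qed.

Lemma of_coord1_continuous x : continuous (fun z : 'rV[R]_N => (of_coord z).1 x).
Proof.
rewrite (_ : (fun z => _) = fun z : 'rV[R]_N => z 0 (lshift _ (enum_rank x))).
  exact: coord_continuous.
by apply/funext => z; rewrite /of_coord /= mxE.
Qed.

Lemma of_coord2_continuous x : continuous (fun z : 'rV[R]_N => (of_coord z).2 x).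
Proof.
rewrite (_ : (fun z => _) = fun z : 'rV[R]_N => z 0 (rshift _ (enum_rank x))).
  exact: coord_continuous.
by apply/funext => z; rewrite /of_coord /= mxE.
Qed.

Lemma open_B r : open (@of_coord R V @^-1` B_ (V := V) r).
Proof.
have c : continuous (fun z : 'rV[R]_N => norm_oo (of_coord z).1 + norm_oo (of_coord z).2).
  have c1 := norm_oo_continuous (u := fun z => (of_coord z).1) of_coord1_continuous.
  have c2 := norm_oo_continuous (u := fun z => (of_coord z).2) of_coord2_continuous.
  by move=> z; exact: (cvgD (c1 z) (c2 z)).
rewrite (_ : _ @^-1` _ = (fun z : 'rV[R]_N =>
  norm_oo (of_coord z).1 + norm_oo (of_coord z).2) @^-1` [set y | y < r])//.
by apply: open_comp; [move=> z _; exact: c|exact: open_lt].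
Qed.

Lemma norm_of_coord_le (z : 'rV[R]_N) :
  `|z| <= norm_oo (of_coord z).1 + norm_oo (of_coord z).2.
Proof.
have n0 u : 0 <= norm_oo u :> R.
  rewrite /norm_oo; elim/big_ind : _ => // a b a0 b0; by rewrite le_max a0.
apply: norm_mx_le => [|i j]; first by rewrite addr_ge0.
rewrite (ord1 i); case: (split_ordP j) => k ->.
  apply: le_trans (_ : norm_oo (of_coord z).1 <= _); last by rewrite lerDl.
  have := norm_oo_ge (of_coord z).1 (enum_val k).
  by rewrite /of_coord /= mxE enum_valK.
apply: le_trans (_ : norm_oo (of_coord z).2 <= _); last by rewrite lerDr.
have := norm_oo_ge (of_coord z).2 (enum_val k).
by rewrite /of_coord /= mxE enum_valK.
Qed.

Lemma bounded_B r : bounded_set (@of_coord R V @^-1` B_ (V := V) r).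
Proof.
exists r; split; first exact: num_real.
move=> M rM z /= zr; apply: le_trans (norm_of_coord_le z) _.
exact: ltW (lt_trans zr rM).
Qed.

Lemma to_coord_eq0 (p : (V -> R) * (V -> R)) : to_coord p = 0 ->
  forall x, p.1 x = 0 /\ p.2 x = 0.
Proof.
move=> /rowP p0 x; split.
  have := p0 (lshift _ (enum_rank x)).
  by rewrite /to_coord row_mxEl !mxE enum_rankK.
have := p0 (rshift _ (enum_rank x)).
by rewrite /to_coord row_mxEr !mxE enum_rankK.
Qed.

Lemma to_coord_lin (p q : (V -> R) * (V -> R)) t :
  to_coord p + t *: to_coord q =
  to_coord ((fun x => p.1 x + t * q.1 x), (fun x => p.2 x + t * q.2 x)).
Proof.
apply/rowP => j; rewrite [LHS]mxE [X in _ + X]mxE /to_coord.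
case: (split_ordP j) => k ->; first by rewrite !row_mxEl !mxE.
by rewrite !row_mxEr !mxE.
Qed.

End Coordinates.

Theorem theorem5 (R : realType) (V : finType) (e : rel V)
  (w : V -> V -> R) (mu : V -> R) (lambda eta : R) (f g : V -> R)
  (e_sym : symmetric e)
  (e_conn : connected_graph e)
  (w_pos : forall x y, e x y -> 0 < w x y)
  (w_sym : forall x y, e x y -> w x y = w y x)
  (mu_pos : forall x, 0 < mu x)
  (lambda_pos : 0 < lambda) (eta_pos : 0 < eta)
  (int_f : 0 < integral_V mu f) (int_g : 0 < integral_V mu g) :
  exists R0 : R, 0 < R0 /\
    forall r : R, R0 <= r ->
      is_degree_XX (calF e w mu lambda eta f g) (B_ (V := V) r)
        (fun=> 0, fun=> 0) 0.
Proof.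
(* On an empty graph the integral of [f] would be an empty sum, hence 0. *)
have [x0 _] : exists x : V, True.
  apply: contrapT => /forallNP nV; move: int_f.
  rewrite /integral_V big1 ?ltxx// => x _; by have := nV x.
pose I1 := integral_V mu (fun=> 1 : R).
have I10 : 0 < I1.
  rewrite /I1 /integral_V (bigD1 x0)//= mulr1 ltr_wpDr//.
  by apply: sumr_ge0 => x _; rewrite mulr1 ltW.
pose ft t x := f x + t * (lambda - f x).
pose gt t x := g x + t * (eta - g x).
(* Bounds [ft t] and [gt t] for all [t] in [0, 1], as these are convex combinations of [f] with
   [lambda] and of [g] with [eta]. *)
pose K := \sum_x `|f x| + \sum_x `|g x| + lambda + eta.
have sf0 (k : V -> R) : 0 <= \sum_x `|k x| by apply: sumr_ge0.
have sfx (k : V -> R) x : `|k x| <= \sum_x `|k x|.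
  by rewrite (bigD1 x)//= lerDl sumr_ge0.
have K0 : 0 <= K.
  by rewrite /K; have := sf0 f; have := sf0 g; lra.
have mixK (k : V -> R) c t x : 0 < c -> 0 <= t <= 1 -> \sum_x `|k x| + c <= K ->
    `|k x + t * (c - k x)| <= K.
  move=> c0 /andP[t0 t1] kK.
  have -> : k x + t * (c - k x) = (1 - t) * k x + t * c by ring.
  rewrite (le_trans (ler_normD _ _))// !normrM (gtr0_norm c0) (ger0_norm t0).
  rewrite ger0_norm ?subr_ge0//; apply: le_trans kK; apply: lerD.
    by apply: le_trans (sfx k x); rewrite ler_piMl//; lra.
  by rewrite ler_piMl// ltW.
(* A lower bound for the means of [ft t] and [gt t], uniform in [t]: these means are convex
   combinations of the mean of [f] with [lambda], and of the mean of [g] with [eta]. *)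
pose d := Num.min (Num.min (integral_V mu f / I1) lambda)
                  (Num.min (integral_V mu g / I1) eta).
have d0 : 0 < d by rewrite !lt_min !divr_gt0// lambda_pos eta_pos.
have [df dl dg de] : [/\ d * I1 <= integral_V mu f, d <= lambda,
    d * I1 <= integral_V mu g & d <= eta].
  by split; rewrite -?ler_pdivlMr// /d !ge_min lexx ?orbT.
have mixI (k : V -> R) c t : 0 <= t <= 1 -> d * I1 <= integral_V mu k -> d <= c ->
    d * I1 <= integral_V mu (fun x => k x + t * (c - k x)).
  move=> /andP[t0 t1] dk dc.
  have -> : integral_V mu (fun x => k x + t * (c - k x)) =
      (1 - t) * integral_V mu k + t * (c * I1).
    rewrite /I1 /integral_V !mulr_sumr -big_split; apply: eq_bigr => x _ /=; ring.
  have h1 := ler_wpM2l (_ : 0 <= 1 - t) dk.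
  have h2 : t * (d * I1) <= t * (c * I1) by rewrite ler_wpM2l// ler_wpM2r// ltW.
  by rewrite subr_ge0 in h1; have := h1 t1; lra.
have [C C0 CP] := zero_bound e_sym e_conn w_pos w_sym mu_pos lambda_pos eta_pos K0 d0.
(* Each of the two norms is at most [C] at a zero; the extra 1 keeps zeros strictly inside the
   ball. *)
exists (C + C + 1); split; first by rewrite ltr_wpDl// addr_ge0.
move=> r rC; rewrite /is_degree_XX.
have y0 : to_coord (fun=> 0 : R, fun=> 0 : R) = 0 :> 'rV[R]_(#|V| + #|V|).
  apply/rowP => j; rewrite /to_coord [RHS]mxE.
  case: (split_ordP j) => k ->; first by rewrite row_mxEl mxE.
  by rewrite row_mxEr mxE.
rewrite y0.
pose h : 'rV[R]_(#|V| + #|V|) := to_coord (fun x => lambda - f x, fun x => eta - g x).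
have segE t z : calFc e w mu lambda eta f g z + t *: h =
    calFc e w mu lambda eta (ft t) (gt t) z.
  rewrite /calFc /h /= to_coord_lin /ft /gt; congr to_coord.
  by congr pair; apply/funext => x /=; rewrite addrA.
have zeroE t z : calFc e w mu lambda eta f g z + t *: h = 0 ->
    half_zero e w mu lambda (ft t) (of_coord z).1 (of_coord z).2 /\
    half_zero e w mu eta (gt t) (of_coord z).2 (of_coord z).1.
  by rewrite segE => /to_coord_eq0 H; split => x; have [] := H x.
have inB t z : 0 <= t <= 1 -> calFc e w mu lambda eta f g z + t *: h = 0 ->
    norm_oo (of_coord z).1 + norm_oo (of_coord z).2 < r.
  move=> t01 /zeroE[Hu Hv].
  have B := CP (ft t) (gt t) _ _ _ _ _ _ _ _ Hu Hv.
  have dI : 0 < d * I1 by rewrite mulr_gt0.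
  have mf := mixI f lambda t t01 df dl.
  have mg := mixI g eta t t01 dg de.
  have {}B x : `|(of_coord z).1 x| <= C /\ `|(of_coord z).2 x| <= C.
    apply: B => //.
    - by move=> y; apply: mixK => //; rewrite /K; have := sf0 g; lra.
    - by move=> y; apply: mixK => //; rewrite /K; have := sf0 f; lra.
    - exact: lt_le_trans dI mf.
    - exact: lt_le_trans dI mg.
  apply: (@le_lt_trans _ _ (C + C)); last by lra.
  by apply: lerD; apply: norm_oo_le => // x; have [] := B x.
apply: (brouwer_degree_eq0 (h := h)).
- exact: open_B.
- exact: bounded_B.
- exact: class_C_calFc.
- by move=> t z t01 _ nAz /(inB t z t01); exact: nAz.
- have E1 (a b : R) : a + 1 * (b - a) = b by ring.
  move=> z _; rewrite -[h]scale1r => /zeroE[Hu Hv].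
  apply: (no_zero_cst w_pos mu_pos lambda_pos eta_pos x0 (u := (of_coord z).1)
    (v := (of_coord z).2)).
  + by move=> x; have := Hu x; rewrite /ft E1.
  + by move=> x; have := Hv x; rewrite /gt E1.
Qed.
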